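(* Let $\mathcal T$ be a locally finite normal tiling of $\mathbb E^d$ by strictly convex $d$-polytopes. (1) If $s$ is a canonical scaling of $\mathcal T$, then the polyhedral complex $\mathcal G_{\mathcal T}=\mathcal G(\mathcal T,s)\subset\mathbb E^{d+1}$ constructed from $s$ is a generatrix of $\mathcal T$. (2) Conversely, if some generatrix of the tiling $\mathcal T$ is given, then there exists a canonical scaling $s$ of $\mathcal T$.
   Context: Normal (face-to-face) means: the intersection of any two cells is either empty or a common face of both. Two cells are adjacent if they share a $(d-1)$-face (hyperface). A chain of cells is a finite sequence of cells in which consecutive cells are adjacent. Canonical scaling. Let $\mathcal F^{d-1}$ be the set of hyperfaces of $\mathcal T$ and $s:\mathcal F^{d-1}\to\mathbb R_+$ a positive function (a scaling). For a $(d-2)$-face $F$ of $\mathcal T$, let $F_1,\dots,F_k$ be all hyperfaces containing $F$, in cyclic order around $F$, and let $\mathbf n_i$ be the unit normal to $F_i$ chosen consistently with the chosen direction of going around $F$. Put $\Delta_s(F)=\sum_{i=1}^k s(F_i)\mathbf n_i$. The scaling $s$ is canonical if $\Delta_s(F)=0$ for every $(d-2)$-face $F$ of $\mathcal T$. Lifts. $\mathbb E^d$ is embedded in $\mathbb E^{d+1}$ as $\{x_{d+1}=0\}$, with orthogonal projection $\Pr:\mathbb E^{d+1}\to\mathbb E^d$; $\mathbf n_0=(0,\dots,0,-1)$. A lift of a $k$-polytope $Q\subset\mathbb E^d$ is a $k$-polytope $\widetilde Q\subset\mathbb E^{d+1}$, not parallel to the normal of $\mathbb E^d$, with $\Pr(\widetilde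 Q)=Q$. If $Q_1\cap Q_2$ is a face of both convex polytopes $Q_1,Q_2$ and $\widetilde Q_1$ is a lift of $Q_1$, a lift of $Q_2$ up to $\widetilde Q_1$ is a lift $\widetilde Q_2$ of $Q_2$ such that $\widetilde Q_1\cap\widetilde Q_2$ is a face of both $\widetilde Q_1,\widetilde Q_2$ and projects onto $Q_1\cap Q_2$. For adjacent $d$-polytopes $Q_1,Q_2$, a lift $\widetilde Q_1$ with normal vector $\mathbf n_1$, and a vector $\mathbf n\in\mathbb E^d$ normal to $Q_1\cap Q_2$, the lift of $Q_2$ up to $\widetilde Q_1$ with normal increment $\mathbf n$ is the unique lift of $Q_2$ up to $\widetilde Q_1$ having normal vector $\mathbf n_1+\mathbf n$. Construction of $\mathcal G(\mathcal T,s)$. Fix an initial cell $P_0$. For adjacent cells $P_i,P_j$ let $\mathbf n_{i,j}$ be the unit normal to $P_i\cap P_j$ directed from $P_i$ to $P_j$. To each chain $[P_0,P_1,\dots,P_k]$ starting at $P_0$ assign a lift $L[P_0,\dots,P_k]$ of $P_k$ with a normal vector: $L[P_0]=P_0$ with normal $\mathbf n_0$; and $L[P_0,\dots,P_k]$ is the lift of $P_k$ up to $L[P_0,\dots,P_{k-1}]$ with normal increment $s(P_{k-1}\cap P_k)\,\mathbf n_{k-1,k}$. The $d$-faces of $\mathcal G(\mathcal T,s)$ are these polytopes, two being identified iff they coincide as point sets; two $d$-faces are adjacent iff they can be represented as $L[P_0,\dots,P_{k-1}]$ and $L[P_0,\dots,P_{k-1},P_k]$; incidences in lower-dimensional faces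 are those generated by these adjacencies (a face is common to $d$-faces $c,c'$ if $c,c'$ are joined by a chain of successively adjacent $d$-faces such that the face lies in each successive common $(d-1)$-face). Generatrix. A generatrix of a tiling $\mathcal T$ of $\mathbb E^d$ is a $d$-dimensional polyhedral manifold in the ambient space $\mathbb E^{d+1}$ whose orthogonal projection to $\mathbb E^d$ is one-to-one and coincides with the tiling $\mathcal T$.
   Formalization: In (2) the given generatrix is also assumed to be a convex surface each of whose d-cells is cut out by a supporting hyperplane; without this (2) is false, since every tiling is its own flat generatrix, yet a nonregular triangulation has no positive canonical scaling. *)

(* Defs.v *)
From HB Require Import structures.
From mathcomp Require Import all_boot all_order all_algebra.
From mathcomp Require Import all_classical all_reals all_analysis.

Set Implicit Arguments.
Unset Strict Implicit.
Unset Printing Implicit Defensive.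

Import Order.TTheory GRing.Theory Num.Theory.
Import numFieldNormedType.Exports.

Local Open Scope classical_set_scope.
Local Open Scope ring_scope.

Section Polytopes.
Context {R : realType} {n : nat}.
Implicit Types (P Q F H X : set 'rV[R]_n) (u v w : 'rV[R]_n).

Definition dotp u v : R := \sum_i u 0 i * v 0 i.

Definition polytope P : Prop :=
  exists s : seq 'rV[R]_n, P = smallest (@convex_set R 'rV[R]_n) [set` s].

(* The rows of A are a basis of the direction space of the affine hull of X. *)
Definition direction_basis (k : nat) X (A : 'M[R]_(k, n)) : Prop :=
  row_free A /\
  exists x0, [/\ X x0, (forall i, X (x0 + row i A))
               & (forall x, X x -> (x - x0 <= A)%MS)].

(* X is nonempty and its affine hull has dimension k. *)
Definition affine_dim (k : nat) X : Prop :=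
  exists A : 'M[R]_(k, n), direction_basis X A.

Definition kpolytope (k : nat) P : Prop := polytope P /\ affine_dim k P.

(* X lies on one side of the hyperplane dotp w x = c and meets it in F; w = 0
   makes X a face of itself.  The empty set is not counted as a face.  Since
   faces of polytopes are cut out by hyperplanes, distinct hyperfaces of a
   polytope never lie in a common hyperplane: this is the strict convexity of
   the cells. *)
Definition face F X : Prop :=
  F !=set0 /\
  exists w c, (forall x, X x -> dotp w x <= c) /\
              F = X `&` [set x | dotp w x = c].

Definition kface (k : nat) F X : Prop := face F X /\ affine_dim k F.

(* (d-1)-faces and (d-2)-faces, stated without truncated subtraction. *)
Definition hyperface (d : nat) F X : Prop := exists2 k, d = k.+1 & kface k F X.
Definition codim2face (d : nat) F X : Prop := exists2 k, d = k.+2 & kface k F X.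

Definition adjacent (d : nat) (T : set (set 'rV[R]_n)) P Q : Prop :=
  [/\ T P, T Q, P <> Q & exists H, hyperface d H P /\ hyperface d H Q].

Definition normal_vector X u : Prop :=
  u != 0 /\ forall x y, X x -> X y -> dotp u (x - y) = 0.

Definition directed_unit_normal H P Q u : Prop :=
  [/\ dotp u u = 1, normal_vector H u
    & forall x y, P x -> Q y -> dotp u x <= dotp u y].

Definition locally_finite (T : set (set 'rV[R]_n)) : Prop :=
  forall x : 'rV[R]_n,
    exists2 U, nbhs x U & finite_set [set P | T P /\ P `&` U !=set0].

End Polytopes.

Section Tilings.
Context {R : realType} {d : nat}.
Implicit Types (T : set (set 'rV[R]_d)) (F H : set 'rV[R]_d).

Definition tiling T : Prop :=
  [/\ (forall P, T P -> kpolytope d P),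
      \bigcup_(P in T) P = [set: 'rV[R]_d]
    & forall P Q, T P -> T Q -> P <> Q -> P° `&` Q° = set0].

Definition normal_tiling T : Prop :=
  forall P Q, T P -> T Q ->
    P `&` Q = set0 \/ (face (P `&` Q) P /\ face (P `&` Q) Q).

Definition tiling_hyperface T H : Prop := exists2 P, T P & hyperface d H P.
Definition tiling_codim2face T F : Prop := exists2 P, T P & codim2face d F P.

(* G lists without repetition all the hyperfaces containing F in a cyclic order
   around F: one passes from the cell C i to the next cell through G i. *)
Definition around T F (k : nat) (C G : 'I_k -> set 'rV[R]_d) : Prop :=
  [/\ injective G,
      (forall H, (tiling_hyperface T H /\ F `<=` H) <-> (exists i, H = G i))
    & forall i, [/\ T (C i), T (C (ordS i)), C i <> C (ordS i),
                    hyperface d (G i) (C i) & hyperface d (G i) (C (ordS i))]].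

(* Only the values of a scaling at the hyperfaces of T matter. *)
Definition scaling T (s : set 'rV[R]_d -> R) : Prop :=
  forall H, tiling_hyperface T H -> 0 < s H.

Definition Delta (s : set 'rV[R]_d -> R) (k : nat) (G : 'I_k -> set 'rV[R]_d)
    (u : 'I_k -> 'rV[R]_d) : 'rV[R]_d :=
  \sum_i s (G i) *: u i.

Definition canonical_scaling T (s : set 'rV[R]_d -> R) : Prop :=
  scaling T s /\
  forall F, tiling_codim2face T F ->
    forall (k : nat) (C G : 'I_k -> set 'rV[R]_d) (u : 'I_k -> 'rV[R]_d),
      around T F C G ->
      (forall i, directed_unit_normal (G i) (C i) (C (ordS i)) (u i)) ->
      Delta s G u = 0.

End Tilings.

Section Lifts.
Context {R : realType} {d : nat}.
Implicit Types (T : set (set 'rV[R]_d)) (P Q : set 'rV[R]_d)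
  (L : set 'rV[R]_(d + 1)) (s : set 'rV[R]_d -> R).

Definition embed (x : 'rV[R]_d) : 'rV[R]_(d + 1) := row_mx x 0.
Definition proj (y : 'rV[R]_(d + 1)) : 'rV[R]_d := lsubmx y.
Definition n0 : 'rV[R]_(d + 1) := row_mx 0 (const_mx (- 1)).

Definition is_lift (k : nat) Q L : Prop :=
  [/\ kpolytope k L,
      (forall A : 'M[R]_(k, d + 1), direction_basis L A -> ~~ (n0 <= A)%MS)
    & proj @` L = Q].

(* L2 is a lift of the d-polytope Q2 up to the lift L1 of Q1. *)
Definition lift_up_to Q1 L1 Q2 L2 : Prop :=
  [/\ is_lift d Q2 L2, face (L1 `&` L2) L1, face (L1 `&` L2) L2
    & proj @` (L1 `&` L2) = Q1 `&` Q2].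

(* chain_lift T s P0 c L N: the chain of cells c, which starts at P0, is
   assigned the lift L, with normal vector N. *)
Inductive chain_lift T s (P0 : set 'rV[R]_d) :
    seq (set 'rV[R]_d) -> set 'rV[R]_(d + 1) -> 'rV[R]_(d + 1) -> Prop :=
| chain_lift_start : chain_lift T s P0 [:: P0] (embed @` P0) n0
| chain_lift_step c P Q L N u L' :
    chain_lift T s P0 (rcons c P) L N ->
    adjacent d T P Q ->
    directed_unit_normal (P `&` Q) P Q u ->
    lift_up_to P L Q L' ->
    normal_vector L' (N + s (P `&` Q) *: embed u) ->
    chain_lift T s P0 (rcons (rcons c P) Q) L' (N + s (P `&` Q) *: embed u).

End Lifts.

(* A complex given by its top-dimensional cells and their adjacencies, which
   generate all other incidences. *)
Record complex (R : realType) (n : nat) := Complex {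
  cells : set (set 'rV[R]_n);
  cell_adj : set 'rV[R]_n -> set 'rV[R]_n -> Prop
}.

Section Complexes.
Context {R : realType} {n : nat}.
Implicit Types (K : complex R n) (f c : set 'rV[R]_n).

Definition body K : set 'rV[R]_n := \bigcup_(c in cells K) c.

(* f is a common face of the d-cells c and c' of the complex, as an incidence
   generated by adjacencies. *)
Inductive incident (d : nat) K f : set 'rV[R]_n -> set 'rV[R]_n -> Prop :=
| incident_self c : cells K c -> face f c -> incident d K f c c
| incident_step c c' c'' H :
    incident d K f c c' -> cell_adj K c' c'' ->
    hyperface d H c' -> hyperface d H c'' -> f `<=` H ->
    face f c'' -> incident d K f c c''.

(* The third clause says that the cells are glued exactly where they meet as
   subsets of the ambient space. *)
Definition polyhedral_complex (d : nat) K : Prop :=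
  [/\ (forall c, cells K c -> kpolytope d c),
      (forall c c', cell_adj K c c' <-> adjacent d (cells K) c c'),
      (forall c c', cells K c -> cells K c' ->
         c `&` c' = set0 \/ incident d K (c `&` c') c c')
    & locally_finite (cells K)].

Definition locally_euclidean (d : nat) (M : set 'rV[R]_n) : Prop :=
  forall x, M x ->
  exists (U : set 'rV[R]_n) (V : set 'rV[R]_d)
         (f : 'rV[R]_n -> 'rV[R]_d) (g : 'rV[R]_d -> 'rV[R]_n),
    [/\ open U /\ U x, open V,
        {within M `&` U, continuous f} /\ {within V, continuous g},
        set_fun (M `&` U) V f /\ set_fun V (M `&` U) g
      & (forall y, (M `&` U) y -> g (f y) = y) /\
        (forall z, V z -> f (g z) = z)].

Definition polyhedral_manifold (d : nat) K : Prop :=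
  polyhedral_complex d K /\ locally_euclidean d (body K).

(* Every cell is cut out of the body by a supporting hyperplane: the body is a
   convex surface (turned up or down) that really bends between cells.  This is
   what the positivity of a scaling reflects: every tiling T has a flat
   generatrix (T itself), and a triangulation usually has nonconvex ones, but a
   nonregular triangulation has no canonical scaling. *)
Definition convex_surface K : Prop := forall c, cells K c -> face c (body K).

End Complexes.

Section Generatrix.
Context {R : realType} {d : nat}.
Implicit Types (T : set (set 'rV[R]_d)) (K : complex R (d + 1)).

Definition generatrix T K : Prop :=
  [/\ polyhedral_manifold d K,
      set_bij (body K) [set: 'rV[R]_d] proj
    & [set proj @` c | c in cells K] = T].

Definition lifted_complex T (s : set 'rV[R]_d -> R) (P0 : set 'rV[R]_d) :
    complex R (d + 1) :=
  let consecutive L L' := exists c P Q N N',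
    chain_lift T s P0 (rcons c P) L N /\
    chain_lift T s P0 (rcons (rcons c P) Q) L' N' in
  {| cells := [set L | exists c N, chain_lift T s P0 c L N];
     cell_adj := fun L L' => consecutive L L' \/ consecutive L' L |}.

End Generatrix.

(* Main.v *)
Require Import Defs.
From HB Require Import structures.
From mathcomp Require Import all_boot all_order all_algebra.
From mathcomp Require Import all_classical all_reals all_analysis.
From mathcomp Require Import finmap ring lra zify.
Set Implicit Arguments.
Unset Strict Implicit.
Unset Printing Implicit Defensive.
Import Order.TTheory GRing.Theory Num.Theory.
Import numFieldNormedType.Exports.
Local Open Scope classical_set_scope.
Local Open Scope ring_scope.

(** A generatrix is the graph of a continuous function that is affine on each cell,
    with gradient a P on the cell P, and the jumps a Q - a P across hyperfaces are
    normal to them. A canonical scaling prescribes such jumps: s (P `&` Q) times the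
    unit normal from P to Q. Its defining equation says that the jumps add up to zero
    around every codimension 2 face, so the question is whether jumps with this
    property are differences of gradients. They are because the complement of the
    skeleton of codimension 3 is simply connected.

    In place of homotopies, generic segments are swept. For a point x the carrier
    of x is the common part of the cells around x; its dimension tells in which
    skeleton x lies, and locally finitely many carriers occur. The cells around x
    are a single one, two (cod1_two_cells), or a cycle in which consecutive ones are
    adjacent (codim2_potential), according as the carrier has codimension 0, 1 or 2; in each
    case the jumps have a potential on these cells (local_potential). From a base
    point inside a cell, potentials are continued along segments that avoid the
    carriers of codimension 3 (segment_potential). The value found at the end in a
    cell Q does not change when the end moves inside Q along a segment spanning with
    the base point a triangle that avoids these carriers (value_triangle), and
    generic triangles do avoid them, since a flat of codimension 3 joined with a
    segment is not the whole space (value_indep). This gives global gradients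
    (global_potential); the constant terms of the affine pieces form a second
    potential (scaling_affine_pieces). All chain lifts are then graphs of these
    pieces (chain_lift_graph), and the incidences of the lifted complex follow from
    the fact that the cells around a point are connected through hyperfaces
    containing it (star_connected).

    Conversely a convex generatrix is the graph of a function f supported along each
    cell by an affine function. Adjacent cells are supported from the same side
    (sign_adj), so the difference of their slopes is, up to one common sign, a
    positive multiple of the unit normal. The lengths of these differences form a
    scaling, whose sum around a face telescopes (canonical_scaling_ex). *)

(** * Linear functionals, flats and convexity *)

Section Scalar.
Context {R : realType} {n : nat}.
Implicit Types (u v w x y : 'rV[R]_n) (t c : R).

Lemma dotpE u v : dotp u v = (u *m v^T) 0 0.
Proof. by rewrite mxE; apply: eq_bigr => i _; rewrite mxE. Qed.

Lemma dotpC u v : dotp u v = dotp v u.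
Proof. by apply: eq_bigr => i _; rewrite mulrC. Qed.

Lemma dotpDr w x y : dotp w (x + y) = dotp w x + dotp w y.
Proof. by rewrite /dotp -big_split /=; apply: eq_bigr => i _; rewrite mxE mulrDr. Qed.

Lemma dotpNr w x : dotp w (- x) = - dotp w x.
Proof. by rewrite /dotp -sumrN; apply: eq_bigr => i _; rewrite mxE mulrN. Qed.

Lemma dotpBr w x y : dotp w (x - y) = dotp w x - dotp w y.
Proof. by rewrite dotpDr dotpNr. Qed.

Lemma dotpZr w t x : dotp w (t *: x) = t * dotp w x.
Proof. by rewrite /dotp mulr_sumr; apply: eq_bigr => i _; rewrite mxE mulrCA. Qed.

Lemma dotpDl w x y : dotp (x + y) w = dotp x w + dotp y w.
Proof. by rewrite dotpC dotpDr !(dotpC w). Qed.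

Lemma dotpNl w x : dotp (- x) w = - dotp x w.
Proof. by rewrite dotpC dotpNr dotpC. Qed.

Lemma dotpBl w x y : dotp (x - y) w = dotp x w - dotp y w.
Proof. by rewrite dotpDl dotpNl. Qed.

Lemma dotpZl w t x : dotp (t *: x) w = t * dotp x w.
Proof. by rewrite dotpC dotpZr dotpC. Qed.

Lemma dotp0l x : dotp 0 x = 0.
Proof. by rewrite -(scale0r 0) dotpZl mul0r. Qed.

Lemma dotp0r x : dotp x 0 = 0.
Proof. by rewrite dotpC dotp0l. Qed.

Lemma dotp_suml (I : Type) (r : seq I) (P : pred I) (F : I -> 'rV[R]_n) x :
  dotp (\sum_(i <- r | P i) F i) x = \sum_(i <- r | P i) dotp (F i) x.
Proof.
apply: (big_ind2 (fun a b => dotp a x = b)) => //; first exact: dotp0l.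
by move=> a1 b1 a2 b2 <- <-; rewrite dotpDl.
Qed.

Lemma dotp_gt0 w : w != 0 -> 0 < dotp w w.
Proof.
move=> w0; have [i wi] : exists i, w 0 i != 0.
  apply: contra_notP (negP w0) => H; apply/eqP/rowP => i; rewrite mxE.
  by apply: contra_notP H => wi; exists i; apply/eqP.
rewrite /dotp (bigD1 i)//= ltr_pwDl//.
  by rewrite -expr2 lt_neqAle eq_sym sqrf_eq0 wi sqr_ge0.
by apply: sumr_ge0 => j _; rewrite -expr2 sqr_ge0.
Qed.

(** The columns of cokermx B are functionals that vanish on B and jointly cut out
    its row space. *)
Lemma sub_annihilator (k m : nat) (A : 'M[R]_(m, n)) (B : 'M[R]_(k, n)) :
  (forall w, B *m w^T = 0 -> A *m w^T = 0) -> (A <= B)%MS.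
Proof.
move=> H; rewrite submxE; apply/eqP/matrixP => i j.
have E (p : nat) (M : 'M[R]_(p, n)) : M *m col j (cokermx B) = col j (M *m cokermx B).
  by apply/matrixP => a b; rewrite !mxE; apply: eq_bigr => l _; rewrite mxE.
have := H (col j (cokermx B))^T; rewrite trmxK !E mulmx_coker.
have -> : col j (0 : 'M[R]_(k, n)) = 0 by apply/matrixP => a b; rewrite !mxE.
by move=> /(_ erefl)/matrixP/(_ i 0); rewrite mxE => ->; rewrite !mxE.
Qed.

Lemma row_mul_dotp (k : nat) (A : 'M[R]_(k, n)) w i :
  (A *m w^T) i 0 = dotp w (row i A).
Proof. by rewrite dotpC dotpE -row_mul [RHS]mxE. Qed.

Lemma sub_dotp0 (k : nat) (A : 'M[R]_(k, n)) w x :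
  A *m w^T = 0 -> (x <= A)%MS -> dotp w x = 0.
Proof.
by move=> Aw /submxP[D ->]; rewrite dotpC dotpE -mulmxA Aw mulmx0 mxE.
Qed.

Definition pt x y t : 'rV[R]_n := x + t *: (y - x).

Lemma pt0 x y : pt x y 0 = x.
Proof. by rewrite /pt scale0r addr0. Qed.

Lemma pt1 x y : pt x y 1 = y.
Proof. by rewrite /pt scale1r addrC subrK. Qed.

Lemma dotp_pt w x y t : dotp w (pt x y t) = dotp w x + t * (dotp w y - dotp w x).
Proof. by rewrite /pt dotpDr dotpZr dotpBr. Qed.

Lemma pt_pt x y a b t : pt (pt x y a) (pt x y b) t = pt x y (a + t * (b - a)).
Proof.
apply/rowP => i; rewrite !mxE; ring.
Qed.

Definition affine_closed (A : set 'rV[R]_n) :=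
  forall x y t, A x -> A y -> A (pt x y t).

(** A flat that contains two points of a line contains the line. *)
Lemma affine_closed_ends A x y a b : affine_closed A -> a != b ->
  A (pt x y a) -> A (pt x y b) -> A x /\ A y.
Proof.
move=> Ac ab Aa Ab; have ba : b - a != 0 by rewrite subr_eq0 eq_sym.
split.
  have := Ac _ _ (- a / (b - a)) Aa Ab.
  by rewrite pt_pt mulfVK// subrr pt0.
have := Ac _ _ ((1 - a) / (b - a)) Aa Ab.
by rewrite pt_pt mulfVK// addrC subrK pt1.
Qed.

(** The affine hull in dual form, as an intersection of hyperplanes: it is compared
    with a set by exhibiting a functional. *)
Definition aff_hull (E : set 'rV[R]_n) : set 'rV[R]_n :=
  [set z | forall w c, (forall e, E e -> dotp w e = c) -> dotp w z = c].

Lemma sub_aff_hull E : E `<=` aff_hull E.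
Proof. by move=> e Ee w c; apply. Qed.

Lemma aff_hull_closed E : affine_closed (aff_hull E).
Proof.
move=> x y t hx hy w c H; rewrite dotp_pt (hx w c H) (hy w c H) subrr; ring.
Qed.

(** E lies in a flat of dimension at most k; contrary to affine_dim this passes to
    subsets. *)
Definition in_flat (k : nat) (E : set 'rV[R]_n) :=
  exists (e0 : 'rV[R]_n) (A : 'M[R]_(k, n)), forall e, E e -> (e - e0 <= A)%MS.

Lemma in_flat_sub k E E' : E `<=` E' -> in_flat k E' -> in_flat k E.
Proof. by move=> EE' [e0 [A H]]; exists e0, A => e /EE' /H. Qed.

Lemma in_flat_setU1 k E p : in_flat k E -> in_flat k.+1 (E `|` [set p]).
Proof.
move=> [e0 [A H]]; exists e0.
have -> : k.+1 = (k + 1)%N by rewrite addn1.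
exists (col_mx A (p - e0)) => e [Ee|->].
  by rewrite (submx_trans (H _ Ee))// -addsmxE addsmxSl.
by rewrite -addsmxE addsmxSr.
Qed.

Lemma affine_dim_in_flat k E : affine_dim k E -> in_flat k E.
Proof. by move=> [A [_ [x0 [_ _ H]]]]; exists x0, A. Qed.

Lemma aff_hull_dim m k C E : affine_dim m C -> in_flat k E -> C `<=` aff_hull E ->
  (m <= k)%N.
Proof.
move=> [B [Bf [c0 [Cc0 Cc _]]]] [e0 [A HA]] CE.
suff : (B <= A)%MS by move=> /mxrankS; rewrite (eqP Bf) => /leq_trans; apply; exact: rank_leq_row.
apply: sub_annihilator => w Aw.
have Hc z : C z -> dotp w z = dotp w e0.
  move=> /CE /(_ w (dotp w e0)); apply => e /HA /(sub_dotp0 Aw).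
  by rewrite dotpBr => /eqP; rewrite subr_eq0 => /eqP.
apply/matrixP => i j; rewrite ord1 row_mul_dotp mxE.
have := Hc _ (Cc i); rewrite dotpDr (Hc _ Cc0); lra.
Qed.

Lemma affine_dim_leq m k C E : affine_dim m C -> in_flat k E -> C `<=` E ->
  (m <= k)%N.
Proof. by move=> mC kE CE; apply: (aff_hull_dim mC kE) => z /CE /sub_aff_hull. Qed.

Lemma affine_dim_uniq m k (C : set 'rV[R]_n) : affine_dim m C -> affine_dim k C -> m = k.
Proof.
move=> mC kC; apply/eqP; rewrite eqn_leq.
by rewrite (affine_dim_leq mC (affine_dim_in_flat kC))// (affine_dim_leq kC (affine_dim_in_flat mC)).
Qed.

Lemma affine_dim_leqn m (C : set 'rV[R]_n) : affine_dim m C -> (m <= n)%N.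
Proof. by move=> [A [/eqP rA _]]; rewrite -rA rank_leq_col. Qed.

Lemma affine_dim_neq0 m (C : set 'rV[R]_n) : affine_dim m C -> C !=set0.
Proof. by move=> [A [_ [x [? _ _]]]]; exists x. Qed.

Lemma row_free_col_mx k (A : 'M[R]_(k, n)) x : row_free A -> ~~ (x <= A)%MS ->
  row_free (col_mx A x).
Proof.
move=> Af xA.
have x0 : x != 0 by apply: contra xA => /eqP ->; rewrite sub0mx.
have dx : (A :&: x)%MS = 0.
  apply/eqP; rewrite -submx0; apply/rV_subP => z; rewrite sub_capmx => /andP[zA].
  move=> /sub_rVP[a E]; rewrite submx0 E; have [->|a0] := eqVneq a 0; first by rewrite scale0r.
  by case/negP: xA; rewrite -(eqmx_scale _ a0) -E.
rewrite /row_free -addsmxE mxrank_disjoint_sum// (eqP Af) rank_rV x0.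
by [].
Qed.

(** A free family of differences of points of X that is as long as possible spans
    all of them. *)
Lemma ex_affine_basis (X : set 'rV[R]_n) x : X x ->
  exists k (A : 'M[R]_(k, n)),
    [/\ row_free A, (forall i, X (x + row i A)) & forall y, X y -> (y - x <= A)%MS].
Proof.
move=> Xx.
pose good k := `[< exists A : 'M[R]_(k, n), row_free A /\ forall i, X (x + row i A) >].
have g0 : exists k, good k.
  exists 0%N; apply/asboolP; exists 0; split; last by case.
  by rewrite /row_free mxrank0.
have gn k : good k -> (k <= n)%N.
  by move=> /asboolP[A [/eqP rA _]]; rewrite -rA; exact: rank_leq_col.
case: (ex_maxnP g0 gn) => k /asboolP[A [Af AX]] kmax.
exists k, A; split=> // y Xy; apply: contrapT => /negP yA.
have : good (k + 1)%N.
  apply/asboolP; exists (col_mx A (y - x)); split; first exact: row_free_col_mx.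
  move=> i; case: (split_ordP i) => j ->.
    by rewrite rowKu.
  by rewrite rowKd row_id addrC subrK.
by move=> /kmax; rewrite addn1 ltnn.
Qed.

Lemma ex_affine_dim (X : set 'rV[R]_n) : X !=set0 -> exists k, affine_dim k X.
Proof.
move=> [x /[dup] Xx /ex_affine_basis[k [A [Af AX XA]]]].
by exists k, A; split=> //; exists x.
Qed.

(** The rows of A are differences of points of X, so every functional that is
    constant on X vanishes on them. *)
Lemma affine_dim_at k (X : set 'rV[R]_n) x : affine_dim k X -> X x ->
  exists A : 'M[R]_(k, n), [/\ row_free A, (forall y, X y -> (y - x <= A)%MS)
    & forall w, (forall y, X y -> dotp w y = dotp w x) -> A *m w^T = 0].
Proof.
move=> kX Xx; have [m [A [Af AX XA]]] := ex_affine_basis Xx.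
have mk : m = k.
  by apply: (affine_dim_uniq _ kX); exists A; split=> //; exists x.
move: kX; subst m => _; exists A; split=> // w Hw.
apply/matrixP => i j; rewrite ord1 row_mul_dotp mxE.
have := Hw _ (AX i); rewrite dotpDr; lra.
Qed.

(** A flat that contains F and z has both A and z - x among its directions, and
    these span a space of rank m.+1. *)
Lemma in_flat_ext m k (F E : set 'rV[R]_n) x z (A : 'M[R]_(m, n)) :
  affine_dim m F -> F x -> row_free A ->
  (forall w, (forall y, F y -> dotp w y = dotp w x) -> A *m w^T = 0) ->
  F `<=` E -> E z -> ~~ (z - x <= A)%MS -> in_flat k E -> (m < k)%N.
Proof.
move=> mF Fx Af AF FE Ez zA [e0 [B HB]].
have : (col_mx A (z - x) <= B)%MS.
  apply: sub_annihilator => w Bw.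
  have Hc y : E y -> dotp w y = dotp w e0.
    by move=> /HB /(sub_dotp0 Bw); rewrite dotpBr => /eqP; rewrite subr_eq0 => /eqP.
  rewrite mul_col_mx AF ?mul0mx; last first.
    by move=> y Fy; rewrite (Hc y) ?(Hc x)//; exact: FE.
  have -> : (z - x) *m w^T = 0.
    apply/matrixP => i j; rewrite !ord1 -dotpE mxE dotpC dotpBr.
    by rewrite (Hc z)// (Hc x) ?subrr//; exact: FE.
  by rewrite col_mx0.
move=> /mxrankS; rewrite (eqP (row_free_col_mx Af zA)) addn1 => /leq_trans; apply.
exact: rank_leq_row.
Qed.

(** Both functionals lie in the kernel of the transpose of A, which is a line. *)
Lemma annihilator_line m (A : 'M[R]_(m, n)) w w' : row_free A -> n = m.+1 ->
  A *m w^T = 0 -> A *m w'^T = 0 -> w != 0 -> exists a, w' = a *: w.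
Proof.
move=> Af nm Aw Aw' w0.
have ker v : A *m v^T = 0 -> (v <= kermx A^T)%MS.
  by move=> Av; apply/sub_kermxP; rewrite -[v]trmxK -trmx_mul Av trmx0.
have rk : \rank (kermx A^T) = 1%N.
  by rewrite mxrank_ker mxrank_tr (eqP Af); move: nm; lia.
have wk := ker _ Aw.
have /eqmxP E : (w == kermx A^T)%MS.
  by rewrite -(geq_leqif (mxrank_leqif_eq wk)) rk rank_rV w0.
by apply/sub_rVP; rewrite E ker.
Qed.

Lemma convexP (P : set 'rV[R]_n) : @convex_set R 'rV[R]_n P <->
  forall x y t, P x -> P y -> 0 <= t -> t <= 1 -> P (pt x y t).
Proof.
split=> [cP x y t Px Py t0 t1|H x y l].
  pose l : {i01 R} := Itv01 t0 t1.
  have := cP y x l; rewrite !in_setE => /(_ Py Px).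
  rewrite /conv /= /pt; congr P; apply/rowP => i; rewrite !mxE /unstable.onem /=; ring.
rewrite !in_setE => Px Py.
have := H y x l%:num Py Px; rewrite ge0 le1 => /(_ isT isT).
rewrite /pt; congr P; apply/rowP => i; rewrite !mxE /unstable.onem /=; ring.
Qed.

Lemma convex_hull_convex (S : set 'rV[R]_n) :
  @convex_set R 'rV[R]_n (smallest (@convex_set R 'rV[R]_n) S).
Proof.
apply/convexP => x y t Hx Hy t0 t1 A [cA SA].
by move/convexP: (cA); apply => //; [apply: Hx | apply: Hy].
Qed.

Lemma polytope_convex (P : set 'rV[R]_n) : polytope P ->
  forall x y t, P x -> P y -> 0 <= t -> t <= 1 -> P (pt x y t).
Proof. by move=> [s ->]; apply/convexP; exact: convex_hull_convex. Qed.

End Scalar.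

(** * Connectedness, compactness and generic points *)

Section Topology.
Context {R : realType}.

(** The segment [0, 1] is connected. Every sweep along a segment below is an
    instance: S is constant near each parameter because the cells near a point
    contain it. *)
Lemma unit_interval_ind (S : R -> Prop) : S 0 ->
  (forall t : R, 0 <= t <= 1 -> \forall t' \near t, 0 <= t' <= 1 -> (S t <-> S t')) ->
  forall t : R, 0 <= t <= 1 -> S t.
Proof.
move=> S0 Sloc.
pose I := `[0, 1]%classic : set R.
have IE t : I t = (0 <= t <= 1) :> Prop by rewrite /I/= in_itv.
have IE1 t : I t -> 0 <= t <= 1 by rewrite IE.
have : I `&` S = I.
  apply: (@segment_connected R 0 1).
  - by exists 0; split=> //; rewrite IE lexx ler01.
  - exists ([set t | I t -> S t]°); first exact: open_interior.
    apply/seteqP; split=> t [It St]; split=> //.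
      have /IE1/Sloc := It; apply: filterS => t' H It'.
      by have [+ _] := H (IE1 _ It'); apply.
    by have /nbhs_singleton/(_ It) := St.
  - exists (~` [set t | I t -> ~ S t]°); first exact: open_closedC (open_interior _).
    apply/seteqP; split=> t [It St]; split=> //.
      by move=> /nbhs_singleton/(_ It).
    apply: contrapT => nSt; apply: St.
    have /IE1/Sloc := It; apply: filterS => t' H It' St'.
    by have [_ /(_ St')] := H (IE1 _ It').
by move=> IS t; rewrite -IE -IS => -[].
Qed.

Lemma cvg_rV_coord (U : topologicalType) m (h : U -> 'rV[R]_m) x :
  (forall j, h y 0 j @[y --> x] --> h x 0 j) -> h y @[y --> x] --> h x.
Proof.
move=> H A [B BN BA].
have : \forall y \near x, forall j, B 0 j (h y 0 j).
  apply: filter_forall => j; exact: (H j _ (BN 0 j)).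
by apply: filterS => y Hy; apply: BA => i j; rewrite ord1; exact: Hy.
Qed.

Lemma dotp_continuous n (w : 'rV[R]_n) : continuous (dotp w).
Proof.
move=> x; rewrite /continuous_at /dotp.
elim: (index_enum _) => [|i r IH].
  under eq_fun do rewrite big_nil.
  by rewrite big_nil => A /nbhs_singleton A0; exact: (@filterE _ (nbhs x) _ (fun=> A 0) (fun=> A0)).
under eq_fun do rewrite big_cons; rewrite big_cons.
have C1 : (fun _ : 'rV[R]_n => w 0 i) @ x --> w 0 i.
  by move=> A /nbhs_singleton A0; exact: (@filterE _ (nbhs x) _ (fun=> A _) (fun=> A0)).
have C2 : (fun y : 'rV[R]_n => y 0 i) @ x --> x 0 i by exact: coord_continuous.
exact: (cvgD (cvgM C1 C2) IH).
Qed.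

Lemma pt_continuous n (x y : 'rV[R]_n) : continuous (pt x y).
Proof.
move=> t; apply: cvg_rV_coord => j.
under eq_fun do rewrite !mxE.
rewrite !mxE; apply: cvgD; first exact: cvg_cst.
by apply: cvgM; [exact: cvg_id | exact: cvg_cst].
Qed.

Lemma homothety_continuous n (x : 'rV[R]_n) h : continuous (fun z => pt x z h).
Proof.
move=> z; apply: cvg_rV_coord => j.
under eq_fun do rewrite !mxE.
rewrite !mxE.
have C1 (r : R) : (fun _ : 'rV[R]_n => r) @ z --> r.
  by move=> A /nbhs_singleton A0; exact: (@filterE _ (nbhs z) _ (fun=> A _) (fun=> A0)).
have C2 : (fun y : 'rV[R]_n => y 0 j) @ z --> z 0 j by exact: coord_continuous.
exact: (cvgD (C1 _) (cvgM (C1 h) (cvgB C2 (C1 _)))).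
Qed.

Lemma pt_continuous2 n (x : 'rV[R]_n) :
  continuous (fun tz : R * 'rV[R]_n => pt x tz.2 tz.1).
Proof.
move=> [t z]; apply: cvg_rV_coord => j /=.
under eq_fun do rewrite !mxE.
rewrite !mxE; apply: cvgD; first exact: cvg_cst.
apply: cvgM; first exact: cvg_fst.
apply: cvgB; last exact: cvg_cst.
apply: (@cvg_comp _ _ _ (fun tz : R * 'rV[R]_n => tz.2) (fun z : 'rV[R]_n => z 0 j)).
  exact: cvg_snd.
exact: coord_continuous.
Qed.

(** A polytope is compact: the hull of x :: s is the cone with apex x over the
    hull of s, a continuous image of the product with [0, 1]. *)
Lemma polytope_compact n (P : set 'rV[R]_n) : polytope P -> compact P.
Proof.
move=> [s ->]; elim: s => [|x s IH].
  suff -> : smallest (@convex_set R 'rV[R]_n) [set` [::]] = set0 by exact: compact0.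
  apply/seteqP; split=> // z Hz; apply: (Hz set0); split=> //.
set H := smallest _ _ in IH.
pose K := [set x] `|` (fun tz : R * 'rV[R]_n => pt x tz.2 tz.1) @` (`[0, 1]%classic `*` H).
have Kc : compact K.
  apply: compactU; first exact: compact_set1.
  apply: continuous_compact.
    by apply: continuous_subspaceT; exact: pt_continuous2.
  by apply: compact_setX => //; exact: segment_compact.
have Hc := @convex_hull_convex R n [set` s].
suff -> : smallest (@convex_set R 'rV[R]_n) [set` x :: s] = K by [].
apply/seteqP; split.
  apply: smallest_sub; last first.
    move=> z /=; rewrite inE => /orP[/eqP->|zs]; first by left.
    right; exists (1, z) => /=; last by rewrite pt1.
    split=> /=; first by rewrite in_itv/= ler01 lexx.
    exact: sub_gen_smallest.
  have KE u : K u <-> exists t z, [/\ 0 <= t, t <= 1, (H z \/ t = 0) & u = pt x z t].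
    split.
      move=> [->|[[t z] [/=]]]; first by exists 0, x; rewrite pt0 lexx ler01; split=> //; right.
      by rewrite in_itv/= => /andP[t0 t1] Hz <-; exists t, z; split=> //; left.
    move=> [t [z [t0 t1 [Hz|t00] ->]]]; last by left; rewrite t00 pt0.
    right; exists (t, z) => //; split=> //=; by rewrite in_itv/= t0 t1.
  apply/convexP => u v r /KE[t [z [t0 t1 Hz ->]]] /KE[t' [z' [t'0 t'1 Hz' ->]]] r0 r1.
  apply/KE; pose tau := (1 - r) * t + r * t'.
  have tau0 : 0 <= tau by apply: addr_ge0; apply: mulr_ge0 => //; lra.
  have tau1 : tau <= 1.
    have : (1 - r) * t <= (1 - r) * 1 by apply: ler_wpM2l => //; lra.
    have : r * t' <= r * 1 by apply: ler_wpM2l.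
    rewrite /tau; lra.
  have [tauz|taun] := eqVneq tau 0.
    have [E1 E2] : (1 - r) * t = 0 /\ r * t' = 0.
      have : 0 <= (1 - r) * t by apply: mulr_ge0 => //; lra.
      have : 0 <= r * t' by apply: mulr_ge0.
      move: tauz; rewrite /tau; lra.
    exists 0, x; split=> //; first by right.
    rewrite /pt; apply/rowP => i; rewrite !mxE.
    transitivity (x 0 i + (1 - r) * t * (z 0 i - x 0 i) + r * t' * (z' 0 i - x 0 i)).
      ring.
    rewrite E1 E2; ring.
  exists tau, (pt z z' (r * t' / tau)); split=> //.
    left; case: Hz => [Hz|tz]; case: Hz' => [Hz'|tz'].
    - move/convexP: Hc; apply => //.
        by apply: divr_ge0 => //; apply: mulr_ge0.
      rewrite ler_pdivrMr ?lt_neqAle 1?eq_sym ?taun// mul1r /tau lerDr.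
      by apply: mulr_ge0 => //; lra.
    - by rewrite tz' mulr0 mul0r pt0.
    - suff -> : r * t' / tau = 1 by rewrite pt1.
      rewrite -[X in X / _](_ : tau = _) ?divff// /tau tz; ring.
    - by case/eqP: taun; rewrite /tau tz tz' !mulr0 addr0.
  apply/rowP => i; rewrite !mxE /tau; field; exact: taun.
have Hxc := @convex_hull_convex R n [set` x :: s].
have Hx : smallest (@convex_set R 'rV[R]_n) [set` x :: s] x.
  by apply: sub_gen_smallest; rewrite /= mem_head.
move=> z [->//|[[t y] [/=]]]; rewrite in_itv/= => /andP[t0 t1] Hy <-.
move/convexP: (Hxc); apply => //; move: Hy; apply: sub_smallest2r => //.
by move=> e /=; rewrite inE orbC => ->.
Qed.

Lemma near_dotp_lt n (w : 'rV[R]_n) c x : dotp w x < c ->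
  \forall y \near x, dotp w y < c.
Proof.
move=> wx; have := @dotp_continuous n w x; move=> /(_ [set r | r < c]); apply.
exact: lt_nbhsl.
Qed.

Lemma near_dotp_gt n (w : 'rV[R]_n) c x : c < dotp w x ->
  \forall y \near x, c < dotp w y.
Proof.
move=> wx; have : dotp (- w) x < - c by rewrite dotpNl ltrN2.
by move=> /near_dotp_lt; apply: filterS => y; rewrite dotpNl ltrN2.
Qed.

Section Interior.
Context {n : nat} (P : set 'rV[R]_n).
Hypothesis Pc : forall x y t, P x -> P y -> 0 <= t -> t <= 1 -> P (pt x y t).

Lemma convex_combination (x : 'rV[R]_n) (v : 'I_n -> 'rV[R]_n) (r : seq 'I_n) :
  P x -> (forall i, P (x + v i)) -> forall c : 'I_n -> R, (forall j, 0 <= c j) ->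
  \sum_(j <- r) c j < 1 -> P (x + \sum_(j <- r) c j *: v j).
Proof.
move=> Px Pv; elim: r => [|i r IH] c c0; first by rewrite !big_nil addr0.
rewrite !big_cons => c1.
have S0 : 0 <= \sum_(j <- r) c j by apply: sumr_ge0.
have ci : 0 < 1 - c i by have := c0 i; lra.
have -> : x + (c i *: v i + \sum_(j <- r) c j *: v j) =
    pt (x + \sum_(j <- r) (c j / (1 - c i)) *: v j) (x + v i) (c i).
  have -> : \sum_(j <- r) (c j / (1 - c i)) *: v j = (1 - c i)^-1 *: \sum_(j <- r) c j *: v j.
    by rewrite scaler_sumr; apply: eq_bigr => j _; rewrite scalerA mulrC.
  apply/rowP => j; rewrite !mxE; field; exact: lt0r_neq0.
apply: Pc => //; last by lra.
apply: IH; first by move=> j; rewrite divr_ge0// ltW.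
by rewrite -mulr_suml ltr_pdivrMr// mul1r; lra.
Qed.

(** The barycentre of a simplex spanned by points of P is interior: barycentric
    coordinates are continuous, and remain positive nearby. *)
Lemma convex_interior : affine_dim n P -> P° !=set0.
Proof.
move=> [A [Af [x [Px PA _]]]].
have Au : A \in unitmx by rewrite -row_free_unit.
pose w j : 'rV[R]_n := (col j (invmx A))^T.
have wE (j : 'I_n) (z : 'rV[R]_n) : dotp (w j) z = (z *m invmx A) 0 j.
  by rewrite dotpC dotpE /w trmxK !mxE; apply: eq_bigr => k _; rewrite !mxE.
have zE z : z = x + \sum_j dotp (w j) (z - x) *: row j A.
  rewrite -[LHS](subrK x) addrC; congr (_ + _).
  rewrite -[LHS](mulmxKV Au) {1}[in LHS]mulmx_sum_row.
  by apply: eq_bigr => j _; rewrite wE.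
(* Barycentric coordinates 1 / n.+1: positive, with sum below 1. *)
pose c0 : R := n.+1%:R^-1.
have c00 : 0 < c0 by rewrite invr_gt0 ltr0n.
pose p := x + \sum_j c0 *: row j A.
have pE j : dotp (w j) (p - x) = c0.
  rewrite /p addrC addKr wE.
  have -> : \sum_(j0 < n) c0 *: row j0 A = const_mx c0 *m A.
    by rewrite mulmx_sum_row; apply: eq_bigr => k _; rewrite mxE.
  by rewrite mulmxK// mxE.
exists p; rewrite /interior /=.
have N1 : \forall y \near p, forall j, dotp (w j) x < dotp (w j) y.
  apply: (@filter_forall _ _ (fun j y => dotp (w j) x < dotp (w j) y) (nbhs p)) => j.
  apply: near_dotp_gt.
  by have := pE j; rewrite dotpBr; lra.
have N2 : \forall y \near p, dotp (\sum_j w j) y < 1 + dotp (\sum_j w j) x.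
  apply: near_dotp_lt; rewrite -ltrBlDr -dotpBr dotp_suml.
  under eq_bigr do rewrite pE.
  rewrite sumr_const card_ord -mulr_natl /c0 ltr_pdivrMr ?ltr0n// mul1r ltr_nat.
  by [].
apply: filterS2 N1 N2 => y y1 y2.
rewrite (zE y); apply: convex_combination => //.
  by move=> j; rewrite dotpBr subr_ge0 ltW.
by rewrite -dotp_suml dotpBr ltrBlDr.
Qed.

End Interior.

(** A convex set is not covered by finitely many flats none of which contains
    it: given a point off all flats but the last and one off the last, each flat
    meets the segment between them in at most one point. *)
Lemma convex_not_covered n (C : set 'rV[R]_n) (fam : set (set 'rV[R]_n)) :
  (forall x y t, C x -> C y -> 0 <= t -> t <= 1 -> C (pt x y t)) ->
  C !=set0 -> finite_set fam ->
  (forall A, fam A -> affine_closed A /\ ~ C `<=` A) ->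
  exists2 p, C p & forall A, fam A -> ~ A p.
Proof.
move=> Cc [c Cc0] /finite_seqP[s ->]; elim: s => [|A s IH] H.
  by exists c => //.
have [|p Cp Hp] := IH; first by move=> B /= Bs; apply: H => /=; rewrite inE Bs orbT.
have [Ac _] := H A (mem_head _ _).
have [q Cq nAq] : exists2 q, C q & ~ A q.
  by apply: contrapT => K; apply: (H A (mem_head _ _)).2 => q Cq; apply: contrapT => nA; apply: K; exists q.
have [Ap|nAp] := pselect (A p); last first.
  by exists p => // B /=; rewrite inE => /orP[/eqP->|/Hp].
(* Infinitely many points of the segment close to p and different from it. *)
pose t (k : nat) : R := k.+1%:R^-1.
have t0 k : 0 < t k by rewrite invr_gt0 ltr0n.
have t1 k : t k <= 1 by rewrite invf_le1 ?ltr0n// ler1n.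
have tI k l : t k = t l -> k = l.
  by move=> /invr_inj/eqP; rewrite eqr_nat => /eqP[].
have [N HN] : exists N, forall k, (N <= k)%N -> forall B, B \in s -> ~ B (pt p q (t k)).
  have {IH} : forall B, B \in s -> affine_closed B /\ ~ B p.
    by move=> B Bs; split; [apply: (H B _).1; rewrite /= inE Bs orbT | exact: Hp].
  elim: (s) => [|B r IH] Hr; first by exists 0%N.
  have [|N HN] := IH; first by move=> B' B'r; apply: Hr; rewrite inE B'r orbT.
  have [Bc Bp] := Hr B (mem_head _ _).
  have [[k0 Bk0]|nB] := pselect (exists k, B (pt p q (t k))); last first.
    by exists N => k Nk B'; rewrite inE => /orP[/eqP-> Bk|/HN]; [apply: nB; exists k | exact].
  exists (maxn N k0.+1) => k; rewrite geq_max => /andP[Nk k0k] B'.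
  rewrite inE => /orP[/eqP-> Bk|/HN]; last by exact.
  apply: Bp; apply: (affine_closed_ends Bc _ Bk0 Bk).1.
  by apply/eqP => /tI E; rewrite E ltnn in k0k.
exists (pt p q (t N)); first by apply: Cc => //; exact: ltW.
move=> B /=; rewrite inE => /orP[/eqP-> AN|]; last exact: HN.
apply: nAq; apply: (@affine_closed_ends _ _ A p q 0 (t N) Ac _ _ AN).2.
  by rewrite eq_sym gt_eqF.
by rewrite pt0.
Qed.

End Topology.

(** * Cells around a point *)

Section Local.
Context {R : realType} {d : nat}.

(** Tube lemma: a small homothety with centre x shrinks X into U. *)
Lemma near_homothety n (x : 'rV[R]_n) (X : set 'rV[R]_n) (U : set 'rV[R]_n) :
  compact X -> nbhs x U -> exists2 h : R, 0 < h <= 1 & forall z, X z -> U (pt x z h).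
Proof.
move=> /compact_near_coveringP Xc xU.
have H : \forall h \near (0 : R), X `<=` [set z | U (pt x z h)].
  apply: (Xc R (nbhs (0 : R)) (fun h z => U (pt x z h))) => z Xz.
  have : (fun tz : R * 'rV[R]_n => pt x tz.2 tz.1) @ (0 : R, z) --> pt x z 0.
    exact: (@pt_continuous2 R n x (0, z)).
  rewrite pt0 => /(_ U xU) [[A B] [/= A0 Bz] AB].
  by exists (B, A) => //= -[z' h] [/= Bz' Ah]; exact: (AB (h, z')).
move: H => /nbhs_ballP[e /= e0 He].
exists (Num.min (e / 2) 1); first by rewrite lt_min ltr01 divr_gt0//= ge_min lexx orbT.
move=> z Xz; apply: He => //=; rewrite /ball/= sub0r normrN ger0_norm.
  by rewrite gt_min; apply/orP; left; lra.
by rewrite le_min ler01 divr_ge0// ltW.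
Qed.

Lemma pt_homothety n (x p q : 'rV[R]_n) h t :
  pt x (pt p q t) h = pt (pt x p h) (pt x q h) t.
Proof. by apply/rowP => i; rewrite !mxE; ring. Qed.

Lemma segment_set_compact n (p q : 'rV[R]_n) :
  compact [set pt p q t | t in `[0, 1]%classic : set R].
Proof.
apply: continuous_compact; last exact: segment_compact.
by apply: continuous_subspaceT; exact: pt_continuous.
Qed.

Context (T : set (set 'rV[R]_d)).
Hypothesis T_tiling : tiling T.
Hypothesis T_normal : normal_tiling T.
Hypothesis T_locfin : locally_finite T.
Implicit Types (P Q S : set 'rV[R]_d) (x y z : 'rV[R]_d).

Lemma cell_convex P : T P ->
  forall x y t, P x -> P y -> 0 <= t -> t <= 1 -> P (pt x y t).
Proof. by case: T_tiling => H _ _ /H [/polytope_convex]. Qed.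

Lemma cell_compact P : T P -> compact P.
Proof. by case: T_tiling => H _ _ /H [/polytope_compact]. Qed.

Lemma cell_dim P : T P -> affine_dim d P.
Proof. by case: T_tiling => H _ _ /H []. Qed.

Lemma cell_cover x : exists2 P, T P & P x.
Proof. by case: T_tiling => _ H _; have : setT x by []; rewrite -H. Qed.

Lemma cell_closed P : T P -> closed P.
Proof. by move=> /cell_compact; apply: compact_closed; exact: norm_hausdorff. Qed.

(** The common part of the cells around x. It is the smallest face containing x of
    each of these cells, and it replaces the face lattice: its dimension says in
    which skeleton x lies. *)
Definition carrier x : set 'rV[R]_d := [set z | forall P, T P -> P x -> P z].

(** Stated by exclusion: the carrier lies in no flat of dimension below d - m. *)
Definition codim_le m x := forall k, (k + m < d)%N -> ~ in_flat k (carrier x).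

Lemma carrier_self x : carrier x x. Proof. by []. Qed.
Arguments carrier_self : clear implicits.

Lemma carrier_sub x y : (forall P, T P -> P y -> P x) -> carrier x `<=` carrier y.
Proof. by move=> H z xz P TP Py; apply: xz => //; exact: H. Qed.

(** Cells are closed, and finitely many of them come near x. *)
Lemma near_star x : \forall y \near x, forall P, T P -> P y -> P x.
Proof.
have [U xU /finite_seqP[s sE]] := T_locfin x.
have H : \forall y \near x, forall P, P \in s -> T P -> P y -> P x.
  elim: (s) => [|P r IH]; first by apply: filterE.
  have HP : \forall y \near x, T P -> P y -> P x.
    have [TP|nTP] := pselect (T P); last by apply: filterE.
    have [Px|nPx] := pselect (P x); first by apply: filterE.
    have : nbhs x (~` P) by apply: open_nbhs_nbhs; split=> //; exact: closed_openC (cell_closed TP).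
    by apply: filterS => y nPy _ /nPy.
  by apply: filterS2 HP IH => y H1 H2 P'; rewrite inE => /orP[/eqP->|/H2].
apply: filterS2 H xU => y H Uy P TP Py; apply: (H P) => //.
have : [set P | T P /\ P `&` U !=set0] P by split=> //; exists y.
by rewrite sE.
Qed.

Lemma compact_meets_finite (X : set 'rV[R]_d) : compact X ->
  finite_set [set P | T P /\ P `&` X !=set0].
Proof.
rewrite compact_cover => Xc.
have /choice[U HU] : forall x, exists U : set 'rV[R]_d,
    nbhs x U /\ finite_set [set P | T P /\ P `&` U !=set0].
  by move=> x; have [U ? ?] := T_locfin x; exists U.
have [||D _ XD] := Xc _ X (fun x => (U x)°).
- by move=> x _; exact: open_interior.
- by move=> x Xx; exists x => //; exact: (HU x).1.
have fin : finite_set (\bigcup_(x in [set` D]) [set P | T P /\ P `&` U x !=set0]).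
  by apply: bigcup_finite; [exact: finite_fset | move=> x _; exact: (HU x).2].
apply: sub_finite_set fin => P [TP [y [Py Xy]]]; have [x Dx Uy] := XD _ Xy.
exists x => //; split=> //; exists y; split=> //; exact: interior_subset.
Qed.

Lemma star_finite x : finite_set [set P | T P /\ P x].
Proof.
apply: sub_finite_set (compact_meets_finite (@compact_set1 _ x)).
by move=> P [TP Px]; split=> //; exists x.
Qed.

(** The carrier of z depends only on which of the finitely many cells meeting X
    contain z. *)
Lemma carrier_finite (X : set 'rV[R]_d) : compact X -> finite_set [set carrier z | z in X].
Proof.
move=> /compact_meets_finite/finite_seqP[s sE].
apply: (@sub_finite_set _ _ ((fun m : (size s).-tuple bool =>
    [set y | forall P, P \in mask m s -> P y]) @` setT)); last first.
  by apply: finite_image; exact: finite_finset.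
move=> _ [z Xz <-].
exists [tuple of map (fun P => `[< T P /\ P z >]) (in_tuple s)] => //.
rewrite /= -filter_mask; apply/seteqP; split=> y Hy P.
  move=> TP Pz; apply: Hy; rewrite mem_filter; apply/andP; split; first exact/asboolP.
  have : [set P | T P /\ P `&` X !=set0] P by split=> //; exists z.
  by rewrite sE.
by rewrite mem_filter => /andP[/asboolP[TP Pz] _]; exact: Hy.
Qed.

(** P has interior points, which would be interior to both cells. *)
Lemma sub_cell_eq P Q : T P -> T Q -> P `<=` Q -> P = Q.
Proof.
move=> TP TQ PQ; apply: contrapT => nPQ.
case: T_tiling => _ _ /(_ P Q TP TQ nPQ) E.
have [p Pp] := convex_interior (cell_convex TP) (cell_dim TP).
suff : (P° `&` Q°) p by rewrite E.
by split=> //; exact: (interiorS PQ).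
Qed.

Lemma cell_not_flat P w c : T P -> (forall z, P z -> dotp w z = c) -> w = 0.
Proof.
move=> TP H; have Pd := cell_dim TP; have [x Px] := affine_dim_neq0 Pd.
have [A [Af _]] := affine_dim_at Pd Px.
move=> /(_ w); rewrite (H _ Px) => /(_ H) Aw.
have Au : A \in unitmx by rewrite -row_free_unit.
by apply: trmx_inj; rewrite trmx0 -(mulKmx Au w^T) Aw mulmx0.
Qed.

Lemma cap_face P Q x : T P -> T Q -> P x -> Q x -> exists w,
  (forall z, P z -> dotp w z <= dotp w x) /\
  (forall z, P z -> (Q z <-> dotp w z = dotp w x)).
Proof.
move=> TP TQ Px Qx; have [E|[[_ [w [c [Pw PQ]]]] _]] := T_normal TP TQ.
  by have : (P `&` Q) x by []; rewrite E.
have xc : dotp w x = c.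
  by have : (P `&` Q) x by []; rewrite PQ => -[].
exists w; rewrite xc; split=> // z Pz; split=> [Qz|wz].
  by have : (P `&` Q) z by []; rewrite PQ => -[].
suff : (P `&` Q) z by case. by rewrite PQ.
Qed.

Lemma cap_functional P Q x : T P -> T Q -> P <> Q -> P x -> Q x -> exists w,
  [/\ w != 0, (forall z, P z -> dotp w z <= dotp w x),
      (forall z, P z -> (Q z <-> dotp w z = dotp w x)) &
      (forall z, carrier x z -> dotp w z = dotp w x)].
Proof.
move=> TP TQ PQ Px Qx; have [w [H1 H2]] := cap_face TP TQ Px Qx.
exists w; split=> //; last by move=> z Fz; apply/H2; exact: Fz.
apply/eqP => w0; apply: PQ; apply: sub_cell_eq => // z Pz; apply/H2 => //.
by rewrite w0 !dotp0l.
Qed.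

(** The functional that cuts the face P `&` Q out of P is maximal at an interior
    point of the segment, hence constant on the segment. *)
Lemma cell_extremal P Q a b t : T P -> T Q -> P a -> P b -> 0 < t -> t < 1 ->
  Q (pt a b t) -> Q a /\ Q b.
Proof.
move=> TP TQ Pa Pb t0 t1 Qt.
have Pt : P (pt a b t) by apply: cell_convex => //; exact: ltW.
have [w [H1 H2]] := cap_face TP TQ Pt Qt.
have := H1 _ Pa; have := H1 _ Pb; rewrite !dotp_pt => Hb Ha.
have E : dotp w b - dotp w a = 0.
  set D := dotp w b - dotp w a in Ha Hb *.
  have D1 : 0 <= t * D by lra.
  have D2 : 0 <= - D * (1 - t) by rewrite /D in Hb *; nra.
  apply/eqP; rewrite eq_le -(pmulr_rge0 _ t0) D1 andbT.
  by rewrite -oppr_ge0 -(pmulr_lge0 (x:=1 - t)) ?subr_gt0.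
split; apply/H2 => //; rewrite dotp_pt E; lra.
Qed.

(** Add up the functionals that cut the intersections with the other cells around x
    out of P. *)
Lemma face_carrier P x : T P -> P x -> face (carrier x) P.
Proof.
move=> TP Px; split; first by exists x.
have /finite_seqP[s sE] := star_finite x.
have Hs Q : Q \in s -> T Q /\ Q x.
  by move=> Qs; have : [set` s] Q by []; rewrite -sE.
have : exists w, (forall z, P z -> dotp w z <= dotp w x) /\
    (forall z, P z -> (dotp w z = dotp w x <-> forall Q, Q \in s -> Q z)).
  elim: (s) Hs => [|Q r IH] Hr.
    by exists 0; split=> z _; rewrite !dotp0l.
  have [|w [H1 H2]] := IH; first by move=> Q' Q'r; apply: Hr; rewrite inE Q'r orbT.
  have [TQ Qx] := Hr Q (mem_head _ _).
  have [w' [H1' H2']] := cap_face TP TQ Px Qx.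
  exists (w + w'); split=> [z Pz|z Pz].
    by rewrite !dotpDl lerD ?H1 ?H1'.
  rewrite !dotpDl; have := H1 _ Pz; have := H1' _ Pz => L1 L2; split.
    move=> E Q'; rewrite inE => /orP[/eqP ->|].
      by apply/H2' => //; lra.
    by move: Q'; apply/H2 => //; lra.
  move=> HQ; congr (_ + _).
    by apply/H2 => // Q' Q'r; apply: HQ; rewrite inE Q'r orbT.
  by apply/H2' => //; apply: HQ; rewrite mem_head.
move=> [w [H1 H2]]; exists w, (dotp w x); split=> //.
apply/seteqP; split=> z.
  move=> Fz; have Pz : P z by exact: Fz.
  split=> //; apply/H2 => // Q Qs; have [TQ Qx] := Hs _ Qs; exact: Fz.
move=> [Pz /= /(H2 _ Pz) HQ] Q TQ Qx; apply: HQ.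
by have : [set Q | T Q /\ Q x] Q by []; rewrite sE.
Qed.

Lemma carrier_dim x : exists2 k, affine_dim k (carrier x) &
  forall m, codim_le m x -> (d <= k + m)%N.
Proof.
have [|k Hk] := @ex_affine_dim _ _ (carrier x); first by exists x.
exists k => // m cx; rewrite leqNgt; apply/negP => /cx; apply.
exact: affine_dim_in_flat.
Qed.

(** Otherwise the functional would vanish on a basis of the whole space. *)
Lemma flat_dim_lt k (X : set 'rV[R]_d) w x : affine_dim k X -> X x -> w != 0 ->
  (forall z, X z -> dotp w z = dotp w x) -> (k < d)%N.
Proof.
move=> Xk Xx w0 Xw; rewrite ltn_neqAle (affine_dim_leqn Xk) andbT.
apply/eqP => kd; subst k.
have [A [Af _ /(_ w Xw) Aw]] := affine_dim_at Xk Xx.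
have Au : A \in unitmx by rewrite -row_free_unit.
case/eqP: w0; apply: trmx_inj; by rewrite trmx0 -(mulKmx Au w^T) Aw mulmx0.
Qed.

Lemma cod0_uniq x P Q : codim_le 0 x -> T P -> T Q -> P x -> Q x -> P = Q.
Proof.
move=> cx TP TQ Px Qx; apply: contrapT => PQ.
have [w [w0 _ _ Fw]] := cap_functional TP TQ PQ Px Qx.
have [k Fk /(_ 0 cx)] := carrier_dim x.
by rewrite addn0 leqNgt (flat_dim_lt Fk (carrier_self x) w0 Fw).
Qed.

Lemma cod1_adjacent x P Q : codim_le 1 x -> T P -> T Q -> P x -> Q x -> P <> Q ->
  Defs.adjacent d T P Q.
Proof.
move=> cx TP TQ Px Qx PQ; split=> //; exists (P `&` Q).
have [E|[fP fQ]] := T_normal TP TQ; first by have : (P `&` Q) x by []; rewrite E.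
have [|k Hk] := @ex_affine_dim _ _ (P `&` Q); first by exists x.
suff dk : d = k.+1 by split; exists k.
have [w [w0 _ H _]] := cap_functional TP TQ PQ Px Qx.
apply/eqP; rewrite eqn_leq (flat_dim_lt Hk (x:=x) _ w0)//; last first.
  by move=> z [Pz Qz]; apply/H.
have [m Fm /(_ 1 cx)] := carrier_dim x; rewrite addn1 => /leq_trans; rewrite andbT; apply.
rewrite ltnS; apply: (affine_dim_leq Fm (affine_dim_in_flat Hk)).
by move=> z Fz; split; exact: Fz.
Qed.

(** Segments inherit every transitive relation that links cells sharing a point of
    the segment, because the cells near a point all contain it. *)
Lemma segment_cells (E : set 'rV[R]_d -> set 'rV[R]_d -> Prop) p q P Q :
  (forall A B C, T A -> T B -> T C -> E A B -> E B C -> E A C) ->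
  (forall t A B, 0 <= t <= 1 -> T A -> T B -> A (pt p q t) -> B (pt p q t) -> E A B) ->
  T P -> T Q -> P p -> Q q -> E P Q.
Proof.
move=> Etr Eloc TP TQ Pp Qq.
suff H : forall t, 0 <= t <= 1 -> forall A, T A -> A (pt p q t) -> E P A.
  by apply: (H 1) => //; rewrite ?ler01 ?lexx// pt1.
apply: unit_interval_ind.
  by move=> A TA Ap; apply: (Eloc 0) => //; rewrite ?pt0 ?ler01 ?lexx.
move=> t t01.
have N : \forall t' \near t, forall A, T A -> A (pt p q t') -> A (pt p q t).
  exact: (@pt_continuous R d p q t _ (near_star (pt p q t))).
apply: filterS N => t' H t'01; split=> HS A TA At.
  by apply: HS => //; exact: H.
have [B TB Bt'] := cell_cover (pt p q t').
by apply: (Etr _ B) => //; [exact: HS | apply: (Eloc t) => //; exact: H].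
Qed.

(** Join points of P and Q close to x inside the open half-space. The carrier of a
    point of this segment contains the point and carrier x, which spans the
    bounding hyperplane; so it has full dimension, and the point lies in a single
    cell. That cell cannot change along the segment. *)
Lemma same_side x w P Q : codim_le 1 x -> (forall z, carrier x z -> dotp w z = dotp w x) ->
  w != 0 -> T P -> T Q -> P x -> Q x ->
  (forall z, P z -> dotp w z <= dotp w x) -> (forall z, Q z -> dotp w z <= dotp w x) ->
  P = Q.
Proof.
move=> cx Fw w0 TP TQ Px Qx wP wQ.
have strict A : T A -> (forall z, A z -> dotp w z <= dotp w x) ->
    exists2 p, A p & dotp w p < dotp w x.
  move=> TA wA; apply: contrapT => H; case/eqP: w0.
  apply: (cell_not_flat (c := dotp w x) TA) => z Az; apply/eqP.
  rewrite eq_le wA//= leNgt; apply/negP => zx; apply: H; by exists z.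
have [p Pp wp] := strict _ TP wP; have [q Qq wq] := strict _ TQ wQ.
have [h /andP[h0 h1] Hh] := near_homothety (@segment_set_compact d p q) (near_star x).
apply: (segment_cells (E := eq) (p := pt x p h) (q := pt x q h)) => //.
- by move=> A B C _ _ _ -> ->.
- move=> t A B t01 TA TB; rewrite -pt_homothety; set y := pt x _ h => Ay By.
  apply: (@cod0_uniq y) => // k kd ik.
  have [m Fm /(_ 1 cx) dm] := carrier_dim x.
  have [D [Df FD DF]] := affine_dim_at Fm (carrier_self x).
  suff : (m < k)%N by move: kd dm; lia.
  apply: (in_flat_ext Fm (carrier_self x) Df DF _ (carrier_self y) _ ik).
    apply: carrier_sub => C TC Cy; apply: (Hh (pt p q t)) => //.
    by exists t => //=; rewrite in_itv.
  apply/negP => /(sub_dotp0 (DF _ Fw)) /eqP; apply/negP; rewrite dotpBr /y !dotp_pt.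
  rewrite lt_eqF// addrAC subrr add0r pmulr_rlt0// subr_lt0.
  move: t01 => /andP[t0 t1]; rewrite -subr_gt0 in wp; rewrite -subr_gt0 in wq.
  have A1 : 0 <= t * (dotp w x - dotp w q) by apply: mulr_ge0 => //; exact: ltW.
  have A2 : 0 <= (1 - t) * (dotp w x - dotp w p) by apply: mulr_ge0; [lra | exact: ltW].
  have [t2|t2] := lerP t (2^-1).
    have : 0 < (1 - t) * (dotp w x - dotp w p) by apply: mulr_gt0 => //; lra.
    lra.
  have : 0 < t * (dotp w x - dotp w q) by apply: mulr_gt0 => //; lra.
  lra.
- by apply: cell_convex => //; exact: ltW.
- by apply: cell_convex => //; exact: ltW.
Qed.

(** If the cells differ, the carrier spans a hyperplane that supports all three, and
    two of them lie on the same side of it. *)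
Lemma cod1_two_cells x P Q S : codim_le 1 x -> T P -> T Q -> T S -> P x -> Q x -> S x ->
  [\/ P = Q, P = S | Q = S].
Proof.
move=> cx TP TQ TS Px Qx Sx.
have [?|PQ] := pselect (P = Q); first by constructor 1.
have [?|PS] := pselect (P = S); first by constructor 2.
constructor 3.
have [w [w0 wP _ Fw]] := cap_functional TP TQ PQ Px Qx.
have [m Fm /(_ 1 cx) dm] := carrier_dim x.
have dm1 : d = m.+1 by have := flat_dim_lt Fm (carrier_self x) w0 Fw; lia.
have [D [Df FD DF]] := affine_dim_at Fm (carrier_self x).
have opp A : T A -> A x -> P <> A -> forall z, A z -> dotp (- w) z <= dotp (- w) x.
  move=> TA Ax PA.
  have [v [v0 vA _ Fv]] := cap_functional TA TP (nesym PA) Ax Px.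
  have [a va] := annihilator_line Df dm1 (DF _ Fw) (DF _ Fv) w0.
  have [a0|a0|a0] := ltrgtP a 0.
  - move=> z /vA; rewrite va !dotpZl !dotpNl; nra.
  - case: PA; apply: (same_side cx Fw w0) => // z /vA.
    by rewrite va !dotpZl ler_pM2l.
  - by case/eqP: v0; rewrite va a0 scale0r.
apply: (same_side (w := - w) cx); rewrite ?oppr_eq0//.
- by move=> z /Fw; rewrite !dotpNl => ->.
- exact: opp.
- exact: opp.
Qed.

End Local.
Arguments carrier_self {R d} T x.
Arguments carrier_dim {R d} T x.

(** * Generic position, connectivity and unit normals *)

Section Genericity.
Context {R : realType} {d : nat} (T : set (set 'rV[R]_d)).
Hypothesis T_tiling : tiling T.
Hypothesis T_normal : normal_tiling T.
Hypothesis T_locfin : locally_finite T.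
Implicit Types (P Q S : set 'rV[R]_d) (x y z : 'rV[R]_d).
Local Notation adj := (Defs.adjacent d T).
Local Notation carrier := (carrier T).
Local Notation codim_le := (codim_le T).

Lemma in_flat_setU_seq k (E : set 'rV[R]_d) (es : seq 'rV[R]_d) :
  in_flat k E -> in_flat (size es + k) (E `|` [set` es]).
Proof.
elim: es => [|e es IH] Ek; first by apply: in_flat_sub Ek => z [|//].
apply: in_flat_sub (in_flat_setU1 e (IH Ek)) => z [Ez|]; first by left; left.
by rewrite /= inE => /orP[/eqP->|zs]; [right | left; right].
Qed.

(** A set of dimension m has points off the join of finitely many flats of
    dimension below d - c with the points of es, as long as these joins have
    dimension below m: such is the inequality between sizes. Local finiteness
    reduces the carriers of points of X to finitely many flats. *)
Lemma generic_point (C X : set 'rV[R]_d) m c (ess : seq (seq 'rV[R]_d)) :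
  (forall x y t, C x -> C y -> 0 <= t -> t <= 1 -> C (pt x y t)) ->
  affine_dim m C -> compact X -> (forall es, es \in ess -> size es + d <= m + c)%N ->
  exists2 p, C p & forall es z, es \in ess -> X z -> ~ codim_le c z ->
    ~ aff_hull (carrier z `|` [set` es]) p.
Proof.
move=> Cc Cm Xc szs.
pose bad := [set carrier z | z in X `&` [set z | ~ codim_le c z]].
have badf : finite_set bad.
  by apply: sub_finite_set (carrier_finite T_locfin Xc) => _ [z [Xz _] <-]; exists z.
pose fam := [set aff_hull (F `|` [set` es]) | F in bad & es in [set` ess]].
have famf : finite_set fam by apply: finite_image2 => //; exact: finite_seq.
have [|p Cp Hp] := convex_not_covered Cc (affine_dim_neq0 Cm) famf; last first.
  exists p => // es z ess_es Xz cz; apply: Hp; exists (carrier z); first by exists z.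
  by exists es.
move=> A [_ [z [Xz /= cz] <-] [es /= /szs sz <-]]; split; first exact: aff_hull_closed.
have [k [kd ik]] : exists k, (k + c < d)%N /\ in_flat k (carrier z).
  by apply: contrapT => H; apply: cz => k kd ik; apply: H; exists k.
move=> /(aff_hull_dim Cm (in_flat_setU_seq es ik)) mk.
have := leq_ltn_trans (leq_trans sz (leq_add mk (leqnn c))).
by move=> /(_ (size es + d)%N); rewrite -addnA ltn_add2l ltnn => /(_ kd).
Qed.

Lemma aff_hull_pt (E : set 'rV[R]_d) p q t : aff_hull E p -> aff_hull E (pt p q t) -> t != 0 ->
  aff_hull E q.
Proof.
move=> Ep Et t0; apply: (@affine_closed_ends _ _ (aff_hull E) p q 0 t _ _ _ _).2 => //.
- exact: aff_hull_closed.
- by rewrite eq_sym.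
- by rewrite pt0.
Qed.

(** If a segment starts off a flat and ends off the join of its start with the
    flat, it misses the flat. *)
Lemma segment_cod c p q t : codim_le c p ->
  (~ codim_le c (pt p q t) -> ~ aff_hull (carrier (pt p q t) `|` [set` [:: p]]) q) ->
  codim_le c (pt p q t).
Proof.
move=> cp H; apply: contrapT => /[dup] nc /H; apply.
have t0 : t != 0 by apply/eqP => t0; apply: nc; rewrite t0 pt0.
apply: (aff_hull_pt _ _ t0).
  by apply: sub_aff_hull; right; rewrite /= inE.
by apply: sub_aff_hull; left; exact: carrier_self.
Qed.

Lemma generic_cod0 (C X : set 'rV[R]_d) :
  (forall x y t, C x -> C y -> 0 <= t -> t <= 1 -> C (pt x y t)) ->
  affine_dim d C -> compact X -> C `<=` X -> exists2 p, C p & codim_le 0 p.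
Proof.
move=> Cc Cd Xc CX.
have [|p Cp Hp] := generic_point (c := 0) (ess := [:: [::]]) Cc Cd Xc.
  by move=> es; rewrite inE => /eqP ->; rewrite /= addn0.
exists p => //; apply: contrapT => cp; apply: (Hp [::] p) => //; first exact: CX.
by apply: sub_aff_hull; left; exact: carrier_self.
Qed.

Lemma generic_segment (C C' X : set 'rV[R]_d) :
  (forall x y t, X x -> X y -> 0 <= t -> t <= 1 -> X (pt x y t)) ->
  (forall x y t, C x -> C y -> 0 <= t -> t <= 1 -> C (pt x y t)) ->
  (forall x y t, C' x -> C' y -> 0 <= t -> t <= 1 -> C' (pt x y t)) ->
  affine_dim d C -> affine_dim d C' -> compact X -> C `<=` X -> C' `<=` X ->
  exists p q, [/\ C p, C' q & forall t, 0 <= t <= 1 -> codim_le 1 (pt p q t)].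
Proof.
move=> Xv Cv C'v Cd C'd Xc CX C'X.
have [p Cp cp] := generic_cod0 Cv Cd Xc CX.
have [|q C'q Hq] := generic_point (c := 1) (ess := [:: [:: p]]) C'v C'd Xc.
  by move=> es; rewrite inE => /eqP ->; rewrite /= addnC.
exists p, q; split=> // t /andP[t0 t1]; apply: segment_cod.
  by move=> k kd; apply: cp; move: kd; lia.
by apply: Hq; [exact: mem_head | apply: Xv => //; [exact: CX | exact: C'X]].
Qed.

Lemma two_cells_hull P Q : T P -> T Q -> exists X : set 'rV[R]_d,
  [/\ compact X, (forall x y t, X x -> X y -> 0 <= t -> t <= 1 -> X (pt x y t)),
      P `<=` X & Q `<=` X].
Proof.
case: T_tiling => Tp _ _ TP TQ.
have [[s Ps] _] := Tp _ TP; have [[s' Qs'] _] := Tp _ TQ.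
have Xp : polytope (smallest (@convex_set R 'rV[R]_d) [set` s ++ s']) by exists (s ++ s').
exists (smallest (@convex_set R 'rV[R]_d) [set` s ++ s']); split.
- exact: polytope_compact.
- exact: polytope_convex.
- rewrite Ps; apply: sub_smallest2r; first exact: convex_hull_convex.
  by move=> e /=; rewrite mem_cat => ->.
- rewrite Qs'; apply: sub_smallest2r; first exact: convex_hull_convex.
  by move=> e /=; rewrite mem_cat orbC => ->.
Qed.

Lemma homothety_convex x h (C : set 'rV[R]_d) :
  (forall x y t, C x -> C y -> 0 <= t -> t <= 1 -> C (pt x y t)) ->
  forall y z t, [set pt x z h | z in C] y -> [set pt x z h | z in C] z ->
  0 <= t -> t <= 1 -> [set pt x z h | z in C] (pt y z t).
Proof.
move=> Cc _ _ t [y Cy <-] [z Cz <-] t0 t1; exists (pt y z t); first exact: Cc.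
by rewrite pt_homothety.
Qed.

Lemma homothety_dim x h (C : set 'rV[R]_d) k : h != 0 -> affine_dim k C ->
  affine_dim k [set pt x z h | z in C].
Proof.
move=> h0 [A [Af [c [Cc CA AC]]]]; exists (h *: A); split.
  by rewrite /row_free (eqmx_scale _ h0).
exists (pt x c h); split; first by exists c.
  move=> i; exists (c + row i A) => //; apply/rowP => j; rewrite !mxE; ring.
move=> _ [z Cz <-].
have -> : pt x z h - pt x c h = h *: (z - c) by apply/rowP => j; rewrite !mxE; ring.
by apply: scalemx_sub; rewrite (eqmx_scale _ h0) AC.
Qed.

(** Shrink two cells towards x and join generic points of them. All cells met by
    this short segment contain x, and two of them at a common point are adjacent,
    because carriers on the segment have codimension at most one. *)
Lemma star_connected x (E : set 'rV[R]_d -> set 'rV[R]_d -> Prop) :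
  (forall A, T A -> A x -> E A A) ->
  (forall A B C, T A -> T B -> T C -> A x -> B x -> C x -> E A B -> E B C -> E A C) ->
  (forall A B, A x -> B x -> adj A B -> E A B) ->
  forall P Q, T P -> T Q -> P x -> Q x -> E P Q.
Proof.
move=> Erefl Etr Eadj P Q TP TQ Px Qx.
have [X [Xc Xv PX QX]] := two_cells_hull TP TQ.
have [h /andP[h0 h1] Hh] := near_homothety Xc (near_star T_tiling T_locfin x).
pose hom C : set 'rV[R]_d := [set pt x z h | z in C].
have h00 : h != 0 by rewrite gt_eqF.
have homc : compact (hom X).
  by apply: continuous_compact => //; apply: continuous_subspaceT; exact: homothety_continuous.
have [||||||||p [q [[p' Pp' Ep] [q' Qq' Eq] pq]]] :=
  @generic_segment (hom P) (hom Q) (hom X).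
- exact: homothety_convex.
- exact: homothety_convex (cell_convex T_tiling TP).
- exact: homothety_convex (cell_convex T_tiling TQ).
- exact: homothety_dim (cell_dim T_tiling TP).
- exact: homothety_dim (cell_dim T_tiling TQ).
- by [].
- by move=> _ [z /PX Xz <-]; exists z.
- by move=> _ [z /QX Xz <-]; exists z.
suff [] : P x /\ Q x /\ E P Q by move=> _ [].
apply: (segment_cells T_tiling T_locfin (E := fun A B => A x /\ B x /\ E A B) (p := p) (q := q)) => //.
- move=> A B C TA TB TC [Ax [Bx AB]] [_ [Cx BC]]; do 2!split=> //.
  exact: (Etr _ B).
- move=> t A B t01 TA TB At Bt.
  have Xt : X (pt p' q' t).
    by move: t01 => /andP[t0 t1]; apply: Xv => //; [exact: PX | exact: QX].
  have near C : T C -> C (pt p q t) -> C x.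
    by move=> TC; rewrite -Ep -Eq -pt_homothety; exact: (Hh _ Xt).
  do ![split; first exact: near].
  have [<-|AB] := pselect (A = B); first by apply: Erefl => //; exact: near.
  by apply: Eadj; [exact: near | exact: near | apply: (cod1_adjacent T_tiling T_normal (pq t t01))].
- by rewrite -Ep; apply: (cell_convex T_tiling) => //; exact: ltW.
- by rewrite -Eq; apply: (cell_convex T_tiling) => //; exact: ltW.
Qed.

Lemma tiling_connected (E : set 'rV[R]_d -> set 'rV[R]_d -> Prop) :
  (forall A, T A -> E A A) ->
  (forall A B C, T A -> T B -> T C -> E A B -> E B C -> E A C) ->
  (forall A B, adj A B -> E A B) ->
  forall P Q, T P -> T Q -> E P Q.
Proof.
move=> Erefl Etr Eadj P Q TP TQ.
have [X [Xc Xv PX QX]] := two_cells_hull TP TQ.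
have [p [q [Pp Qq pq]]] := generic_segment Xv (cell_convex T_tiling TP)
  (cell_convex T_tiling TQ) (cell_dim T_tiling TP) (cell_dim T_tiling TQ) Xc PX QX.
apply: (segment_cells T_tiling T_locfin Etr _ TP TQ Pp Qq) => t A B t01 TA TB At Bt.
have [<-|AB] := pselect (A = B); first exact: Erefl.
by apply: Eadj; apply: (cod1_adjacent T_tiling T_normal (pq t t01)).
Qed.

(** Take a point of P `&` Q off the hulls of all S `&` (P `&` Q), where S is a cell
    not containing P `&` Q. *)
Lemma cap_relint P Q : T P -> T Q -> P `&` Q !=set0 ->
  exists2 x, carrier x = P `&` Q & (P `&` Q) x.
Proof.
move=> TP TQ PQ0.
pose fam := [set aff_hull (S `&` (P `&` Q)) | S in
  [set S | T S /\ S `&` P !=set0] `&` [set S | ~ P `&` Q `<=` S]].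
have famf : finite_set fam.
  apply: finite_image; apply: finite_setIl.
  exact: compact_meets_finite (cell_compact T_tiling TP).
have Cv x y t : (P `&` Q) x -> (P `&` Q) y -> 0 <= t -> t <= 1 -> (P `&` Q) (pt x y t).
  by move=> [Px Qx] [Py Qy] t0 t1; split; apply: (cell_convex T_tiling).
have [|x PQx Hx] := convex_not_covered Cv PQ0 famf.
  move=> _ [S [[TS [x [Sx Px]]] nS] <-]; split; first exact: aff_hull_closed.
  move=> H; apply: nS => z PQz.
  have [w [_ Hw]] := cap_face T_normal TP TS Px Sx.
  apply/Hw; first by case: PQz.
  by apply: (H z PQz) => e [Se [Pe _]]; apply/Hw.
exists x => //; apply/seteqP; split=> z.
  by case: PQx => Px Qx Fz; split; exact: Fz.
move=> PQz S TS Sx; apply: contrapT => nSz.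
apply: (Hx (aff_hull (S `&` (P `&` Q)))); last by apply: sub_aff_hull; split.
exists S => //; split; first by split=> //; exists x; split=> //; case: PQx.
by move=> /(_ z PQz).
Qed.

Lemma adjC P Q : adj P Q -> adj Q P.
Proof. by case=> TP TQ PQ [H [HP HQ]]; split=> //; [exact: nesym | exists H]. Qed.

(** A supporting hyperplane of H and the one of P `&` Q both contain H `&` Q, which
    spans a hyperplane; so they coincide. *)
Lemma hyperface_cap P Q H x : T P -> T Q -> P <> Q -> hyperface d H P ->
  H x -> Q x -> (forall k, (k + 1 < d)%N -> ~ in_flat k (H `&` Q)) -> H = P `&` Q.
Proof.
move=> TP TQ PQ [k dk [[_ [v [c [vP HE]]]] Hk]] Hx Qx dimH.
have [Px vx] : P x /\ dotp v x = c by move: Hx; rewrite HE => -[].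
have [w [w0 wP PQw _]] := cap_functional T_tiling T_normal TP TQ PQ Px Qx.
have HP z : H z -> P z /\ dotp v z = dotp v x by rewrite HE vx => -[].
have v0 : v != 0.
  apply/eqP => v0; have HP' : H = P.
    by rewrite HE; apply/seteqP; split=> z; [case | move=> Pz; split=> //=; rewrite -vx v0 !dotp0l].
  have := affine_dim_uniq Hk; rewrite HP' => /(_ _ (cell_dim T_tiling TP)); lia.
have [|m Hm] := @ex_affine_dim _ _ (H `&` Q); first by exists x.
have dm1 : (d <= m + 1)%N.
  by rewrite leqNgt; apply/negP => /dimH; apply; exact: affine_dim_in_flat.
have vH z : (H `&` Q) z -> dotp v z = dotp v x by move=> [/HP[]].
have wH z : (H `&` Q) z -> dotp w z = dotp w x.
  by move=> [/HP[Pz _] Qz]; apply/PQw.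
have HQx : (H `&` Q) x by [].
have dm : d = m.+1.
  by have := flat_dim_lt Hm HQx w0 wH; lia.
have [D [Df _ DH]] := affine_dim_at Hm HQx.
have [a va] := annihilator_line Df dm (DH _ wH) (DH _ vH) w0.
have a0 : a != 0 by apply: contra v0 => /eqP a0; rewrite va a0 scale0r.
rewrite HE -vx; apply/seteqP; split=> z [Pz Hz]; split=> //.
  apply/PQw => //; move: Hz; rewrite /= va !dotpZl.
  exact: mulfI.
by rewrite /= va !dotpZl; congr (_ * _); apply/PQw.
Qed.

Lemma adjacent_cap P Q : adj P Q -> exists k,
  [/\ d = k.+1, affine_dim k (P `&` Q), hyperface d (P `&` Q) P,
      hyperface d (P `&` Q) Q &
      forall H, hyperface d H P -> hyperface d H Q -> H = P `&` Q].
Proof.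
case=> TP TQ PQ [H [HP HQ]].
have E H' : hyperface d H' P -> hyperface d H' Q -> H' = P `&` Q.
  move=> H'P [k dk [[[x H'x] [v [c [_ H'E]]]] H'k]].
  have H'Q z : H' z -> Q z by rewrite H'E => -[].
  apply: (@hyperface_cap P Q H' x) => //; first exact: H'Q.
  move=> m md im; have := affine_dim_leq H'k im.
  suff /[swap]/[apply] : H' `<=` H' `&` Q by move: md; rewrite dk; lia.
  by move=> z H'z; split=> //; exact: H'Q.
have HE := E _ HP HQ; subst H.
by case: (HP) => k dk [_ Hk]; exists k.
Qed.

Lemma adjacent_relint P Q : adj P Q ->
  exists x, [/\ P x, Q x, carrier x = P `&` Q & codim_le 1 x].
Proof.
move=> /[dup] /adjacent_cap[k [dk Hk _ _ _]] [TP TQ _ _].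
have [x Fx [Px Qx]] := cap_relint TP TQ (affine_dim_neq0 Hk).
exists x; split=> // m; rewrite Fx => md /(affine_dim_leq Hk) /(_ (@subset_refl _ _)).
move: md; rewrite dk; lia.
Qed.

(** The functional that supports P at the common hyperface supports Q from the other
    side, by same_side. *)
Lemma adjacent_separated P Q : adj P Q -> exists w x, [/\ w != 0, P x /\ Q x,
  (forall z, P z -> dotp w z <= dotp w x), (forall z, Q z -> dotp w x <= dotp w z) &
  (forall z, P z -> Q z -> dotp w z = dotp w x)].
Proof.
move=> /[dup] PQa /adjacent_relint[x [Px Qx Fx cx]]; case: PQa => TP TQ PQ _.
have [w [w0 wP _ wF]] := cap_functional T_tiling T_normal TP TQ PQ Px Qx.
have [v [v0 vQ _ vF]] := cap_functional T_tiling T_normal TQ TP (nesym PQ) Qx Px.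
have [m Fm /(_ 1 cx) dm] := carrier_dim T x.
have dm1 : d = m.+1 by have := flat_dim_lt Fm (carrier_self T x) w0 wF; lia.
have [D [Df _ DF]] := affine_dim_at Fm (carrier_self T x).
have [a va] := annihilator_line Df dm1 (DF _ wF) (DF _ vF) w0.
exists w, x; split=> //; last first.
  by move=> z Pz Qz; apply: wF; rewrite Fx.
have [a0|a0|a0] := ltrgtP a 0.
- by move=> z /vQ; rewrite va !dotpZl; rewrite ler_nM2l.
- case: PQ; apply: (same_side T_tiling T_normal T_locfin cx wF) => // z /vQ.
  by rewrite va !dotpZl ler_pM2l.
- by case/eqP: v0; rewrite va a0 scale0r.
Qed.

Lemma adjacent_unit_normal P Q : adj P Q ->
  exists u, directed_unit_normal (P `&` Q) P Q u.
Proof.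
move=> /adjacent_separated[w [x [w0 [Px Qx] wP wQ wPQ]]].
pose r := Num.sqrt (dotp w w); have ww := dotp_gt0 w0.
have r0 : 0 < r by rewrite sqrtr_gt0.
exists (r^-1 *: w); split.
- rewrite dotpZl dotpZr mulrA -expr2 exprVn sqr_sqrtr ?mulVf ?gt_eqF//; exact: ltW.
- split; first by rewrite scaler_eq0 negb_or invr_eq0 gt_eqF.
  move=> y z [Py Qy] [Pz Qz]; rewrite dotpZl dotpBr wPQ// (wPQ z)// subrr mulr0 //.
- move=> y z Py Qz; rewrite !dotpZl ler_pM2l ?invr_gt0//.
  exact: le_trans (wP _ Py) (wQ _ Qz).
Qed.

(** Two normals of the hyperplane of P `&` Q are proportional, and a negative ratio
    would make u constant on P. *)
Lemma unit_normal_scale P Q u v : adj P Q -> directed_unit_normal (P `&` Q) P Q u ->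
  (forall y z, P y -> Q y -> P z -> Q z -> dotp v (y - z) = 0) ->
  (forall y z, P y -> Q z -> dotp v y <= dotp v z) ->
  v = Num.sqrt (dotp v v) *: u.
Proof.
move=> PQa [uu [u0 un] ud] vn vd.
have [x [Px Qx Fx cx]] := adjacent_relint PQa.
have [k [dk Hk _ _ _]] := adjacent_cap PQa.
case: PQa => TP TQ PQ _.
have PQx : (P `&` Q) x by [].
have [D [Df _ DF]] := affine_dim_at Hk PQx.
have uF z : (P `&` Q) z -> dotp u z = dotp u x.
  by move=> PQz; apply/eqP; rewrite -subr_eq0 -dotpBr un.
have vF z : (P `&` Q) z -> dotp v z = dotp v x.
  by move=> [Pz Qz]; apply/eqP; rewrite -subr_eq0 -dotpBr vn.
have [a va] := annihilator_line Df dk (DF _ uF) (DF _ vF) u0.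
suff a0 : 0 <= a by rewrite [in Num.sqrt _]va dotpZl dotpZr uu mulr1 -expr2 sqrtr_sqr ger0_norm.
rewrite leNgt; apply/negP => a0.
case/eqP: u0; apply: (cell_not_flat T_tiling (c := dotp u x) TP) => z Pz.
apply/eqP; rewrite eq_le ud//=.
by have := vd _ _ Pz Qx; rewrite va !dotpZl ler_nM2l.
Qed.

Lemma unit_normal_uniq P Q u v : adj P Q -> directed_unit_normal (P `&` Q) P Q u ->
  directed_unit_normal (P `&` Q) P Q v -> v = u.
Proof.
move=> PQa Hu [vv [_ vn] vd]; rewrite (unit_normal_scale PQa Hu _ vd).
  by rewrite vv sqrtr1 scale1r.
by move=> y z Py Qy Pz Qz; apply: vn.
Qed.

Lemma unit_normal_opp P Q u : directed_unit_normal (P `&` Q) P Q u ->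
  directed_unit_normal (Q `&` P) Q P (- u).
Proof.
move=> [uu [u0 un] ud]; split.
- by rewrite dotpNl dotpNr opprK.
- by split; [rewrite oppr_eq0 | move=> y z; rewrite setIC dotpNl => Hy Hz; rewrite un ?oppr0].
- by move=> y z Qy Pz; rewrite !dotpNl lerN2 ud.
Qed.

End Genericity.

(** * Cycles in graphs *)

(** A walk that never turns back must repeat a vertex. A shortest closed piece of it
    visits distinct vertices, and it contains both neighbours of each of them, so
    by connectedness it exhausts the graph. *)
Lemma cycle_graph (V : Type) (X : set V) (e : V -> V -> Prop) : finite_set X ->
  X !=set0 ->
  (forall P Q, e P Q -> X P /\ X Q) -> (forall P Q, e P Q -> e Q P) ->
  (forall P, ~ e P P) ->
  (forall P, X P -> exists Q1 Q2, [/\ Q1 <> Q2, e P Q1 & e P Q2]) ->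
  (forall P Q1 Q2 Q3, e P Q1 -> e P Q2 -> e P Q3 -> [\/ Q1 = Q2, Q1 = Q3 | Q2 = Q3]) ->
  (forall B : set V, B `&` X !=set0 -> (forall P Q, B P -> e P Q -> B Q) -> X `<=` B) ->
  exists k (C : 'I_k -> V), [/\ injective C, (forall i : 'I_k, ordS (ordS i) <> i),
    (forall i, e (C i) (C (ordS i))) &
    forall P Q, e P Q -> exists i, (P = C i /\ Q = C (ordS i)) \/ (Q = C i /\ P = C (ordS i))].
Proof.
move=> Xf [P0 XP0] eX eC e0 e2 e3 conn.
have [Q0 [_ [_ PQ0 _]]] := e2 _ XP0.
have /choice[f Hf] : forall pq : V * V, exists r, e pq.1 pq.2 -> e pq.2 r /\ r <> pq.1.
  move=> [P Q] /=; have [ePQ|n] := pselect (e P Q); last by exists P.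
  have [R1 [R2 [R12 eR1 eR2]]] := e2 _ (eX _ _ ePQ).2.
  have [E|n] := pselect (R1 = P); last by exists R1.
  by exists R2 => _; split=> // E2; apply: R12; rewrite E E2.
(* The state of the walk is the pair of its last two vertices. *)
pose st n := iter n (fun pq : V * V => (pq.2, f pq)) (P0, Q0).
pose c n := (st n).1.
have cS n : e (c n) (c n.+1) by elim: n => [//|n IH]; exact: (Hf _ IH).1.
have cSS n : c n.+2 <> c n by exact: (Hf _ (cS n)).2.
have [i0 [k0 [k00 ck0]]] : exists i k, (0 < k)%N /\ c i = c (i + k)%N.
  apply: contrapT => H; apply: infinite_nat.
  have ci : injective c.
    move=> i j cij; apply: contrapT => /eqP; rewrite neq_ltn => /orP[ij|ij]; apply: H.
      by exists i, (j - i)%N; rewrite subn_gt0 ij subnKC// ltnW.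
    by exists j, (i - j)%N; rewrite subn_gt0 ij subnKC// ltnW.
  have fin : finite_set (c @^-1` X) by apply: finite_preimage => // m n _ _; exact: ci.
  by apply: sub_finite_set fin => n _; exact: (eX _ _ (cS n)).1.
have /ex_minnP[k /asboolP[k_gt0 [i ci]] kmin] :
    exists k, `[< (0 < k)%N /\ exists i, c i = c (i + k)%N >].
  by exists k0; apply/asboolP; split=> //; exists i0.
have k2 : (2 < k)%N.
  case: k k_gt0 ci {kmin} => // -[|[|k]]// _.
    by rewrite addn1 => E; have := cS i; rewrite -E => /e0.
  by rewrite addn2 => E; case: (cSS i).
pose C (m : 'I_k) := c (i + m)%N.
have CI : injective C.
  move=> m m' E; apply/val_inj/eqP; rewrite eqn_leq.
  have H (a b : 'I_k) : C a = C b -> (a < b)%N -> False.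
    move=> Eab ab; have : (k <= b - a)%N.
      apply: kmin; apply/asboolP; rewrite subn_gt0; split=> //.
      by exists (i + a)%N; rewrite -addnA subnKC// ltnW.
    have := ltn_ord b; lia.
  apply/andP; split; rewrite leqNgt; apply/negP; apply: H => //.
have CS m : C (ordS m) = c (i + m).+1.
  rewrite /C /=; have [mk|] := ltnP m.+1 k; first by rewrite modn_small// addnS.
  move=> km; have -> : m.+1 = k by apply/eqP; rewrite eqn_leq km ltn_ord.
  rewrite modnn addn0 ci -addnS; congr (c (i + _)%N).
  by apply/eqP; rewrite eqn_leq km ltn_ord.
have SS (m : 'I_k) : ordS (ordS m) <> m.
  move=> /(congr1 val) /=; rewrite -addn1 modnDml addn1.
  have := ltn_ord m; have [mk _|km mk] := ltnP m.+2 k.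
    by rewrite modn_small//; lia.
  have -> : m.+2 = (m.+2 - k + k)%N by rewrite subnK.
  rewrite modnDr modn_small; lia.
have eCS m : e (C m) (C (ordS m)) by rewrite CS; exact: cS.
have eCP m : e (C m) (C (ord_pred m)) by apply: eC; have := eCS (ord_pred m); rewrite ord_predK.
have nb m Q : e (C m) Q -> Q = C (ordS m) \/ Q = C (ord_pred m).
  move=> mQ; have [/CI E|<-|<-] := e3 _ _ _ _ (eCS m) (eCP m) mQ; last by right.
    by have := SS (ord_pred m); rewrite ord_predK E.
  by left.
have XC : X `<=` range C.
  apply: conn; first by exists (C (Ordinal k_gt0)); split; [exists (Ordinal k_gt0) | exact: (eX _ _ (eCS _)).1].
  by move=> _ Q [m _ <-] /nb[->|->]; [exists (ordS m) | exists (ord_pred m)].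
exists k, C; split=> // P Q ePQ; have [/XC[m _ mP] _] := eX _ _ ePQ.
move: ePQ; rewrite -mP => /nb[->|->]; first by exists m; left.
by exists (ord_pred m); right; rewrite ord_predK.
Qed.

(** The potential is given by partial sums around the cycle. *)
Lemma cycle_potential (V : Type) (W : zmodType) k (C : 'I_k -> V) (j : 'I_k -> W) :
  injective C -> \sum_i j i = 0 ->
  exists a : V -> W, forall i, a (C (ordS i)) - a (C i) = j i.
Proof.
move=> CI j0.
pose a P := if [pick m | `[< C m = P >]] is Some m then \sum_(i < k | (i < m)%N) j i else 0.
have aC m : a (C m) = \sum_(i < k | (i < m)%N) j i.
  rewrite /a; case: pickP => [m' /asboolP/CI -> //|/(_ m)/asboolP].
  by [].
exists a => i; rewrite !aC.
have S : \sum_(l < k | (l < i.+1)%N) j l = \sum_(l < k | (l < i)%N) j l + j i.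
  rewrite (bigD1 i)/= ?ltnS// addrC; congr (_ + _); apply: eq_bigl => l.
  by rewrite ltnS ltn_neqAle andbC.
have [ik|ki] := ltnP i.+1 k.
  rewrite (eq_bigl (fun l : 'I_k => (l < i.+1)%N)); last by move=> l /=; rewrite modn_small.
  by rewrite S addrC addKr.
have iE : i.+1 = k by apply/eqP; rewrite eqn_leq ki ltn_ord.
rewrite big_pred0; last by move=> l /=; rewrite iE modnn.
move: S; rewrite (eq_bigl predT); last by move=> l; rewrite iE ltn_ord.
by rewrite j0 => S; rewrite sub0r; apply/eqP; rewrite eq_sym -addr_eq0 addrC -S.
Qed.

(** * Cells around a codimension 2 face *)

(** The three functionals live in the plane of functionals vanishing on A, so they
    satisfy a linear relation; evaluating it at g1, g2 and g3 shows that any two of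
    its coefficients have opposite signs. *)
Lemma three_functionals (R : realType) (d k : nat) (A : 'M[R]_(k, d)) (w1 w2 w3 g1 g2 g3 : 'rV[R]_d) :
  row_free A -> d = k.+2 ->
  A *m w1^T = 0 -> A *m w2^T = 0 -> A *m w3^T = 0 ->
  dotp w1 g1 = 0 -> dotp w2 g2 = 0 -> dotp w3 g3 = 0 ->
  dotp w1 g2 < 0 -> dotp w1 g3 < 0 -> dotp w2 g1 < 0 -> dotp w2 g3 < 0 ->
  dotp w3 g1 < 0 -> dotp w3 g2 < 0 -> False.
Proof.
move=> Af dk A1 A2 A3 w11 w22 w33 w12 w13 w21 w23 w31 w32.
pose W := col_mx w1 (col_mx w2 w3).
have WA : (W <= kermx A^T)%MS.
  apply/sub_kermxP; rewrite -[W]trmxK -trmx_mul /W !tr_col_mx !mul_mx_row A1 A2 A3.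
  by rewrite !row_mx0 trmx0.
have rk : (\rank W <= 2)%N.
  by apply: leq_trans (mxrankS WA) _; rewrite mxrank_ker mxrank_tr (eqP Af) dk; lia.
have K0 : kermx W != 0 by rewrite -mxrank_eq0 mxrank_ker; move: rk; lia.
pose u := nz_row (kermx W).
have u0 : u != 0 by rewrite nz_row_eq0.
have uW : u *m W = 0 by apply/sub_kermxP; exact: nz_row_sub.
pose a1 := lsubmx u 0 0; pose a2 := lsubmx (rsubmx u) 0 0; pose a3 := rsubmx (rsubmx u) 0 0.
have comb g : a1 * dotp w1 g + a2 * dotp w2 g + a3 * dotp w3 g = 0.
  have : u *m W *m g^T = 0 by rewrite uW mul0mx.
  rewrite /W -{1}[u]hsubmxK -{1}[rsubmx u]hsubmxK !mul_row_col !mulmxDl -!mulmxA.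
  move=> /matrixP/(_ 0 0); rewrite !dotpE !mxE !big_ord1 !mxE /a1 /a2 /a3 !mxE.
  by rewrite addrA.
have E1 := comb g1; have E2 := comb g2; have E3 := comb g3.
rewrite w11 mulr0 add0r in E1; rewrite w22 mulr0 addr0 in E2; rewrite w33 mulr0 addr0 in E3.
have a30 : a3 = 0.
  have [a3n|a3p|//] := ltrgtP a3 0.
    have a2p : 0 < a2 by nra.
    have a1p : 0 < a1 by nra.
    nra.
  have a2n : a2 < 0 by nra.
  have a1n : a1 < 0 by nra.
  nra.
rewrite a30 mul0r addr0 in E1; rewrite a30 mul0r addr0 in E2.
have a20 : a2 = 0 by move/eqP: E1; rewrite mulf_eq0 (lt_eqF w21) orbF => /eqP.
have a10 : a1 = 0 by move/eqP: E2; rewrite mulf_eq0 (lt_eqF w12) orbF => /eqP.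
case/eqP: u0; rewrite -[u]hsubmxK -[rsubmx u]hsubmxK.
have -> : lsubmx u = 0 by apply/matrixP => i j; rewrite !ord1 [LHS]a10 mxE.
have -> : lsubmx (rsubmx u) = 0 by apply/matrixP => i j; rewrite !ord1 [LHS]a20 mxE.
have -> : rsubmx (rsubmx u) = 0 by apply/matrixP => i j; rewrite !ord1 [LHS]a30 mxE.
by rewrite !row_mx0.
Qed.

Section Codim2.
Context {R : realType} {d : nat} (T : set (set 'rV[R]_d)).
Hypothesis T_tiling : tiling T.
Hypothesis T_normal : normal_tiling T.
Hypothesis T_locfin : locally_finite T.
Implicit Types (P Q S H : set 'rV[R]_d).
Local Notation adj := (Defs.adjacent d T).
Local Notation carrier := (carrier T).
Local Notation codim_le := (codim_le T).

Section AtFace.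
Context (x : 'rV[R]_d) (k : nat) (A : 'M[R]_(k, d)).
Hypothesis dk : d = k.+2.
Hypothesis Fk : affine_dim k (carrier x).
Hypothesis Af : row_free A.
Hypothesis FA : forall y, carrier x y -> (y - x <= A)%MS.
Hypothesis AF : forall w, (forall y, carrier x y -> dotp w y = dotp w x) -> A *m w^T = 0.

(** The carrier of y contains y and carrier x, so its dimension exceeds k. *)
Lemma off_face_cod1 y : (forall P, T P -> P y -> P x) -> ~~ (y - x <= A)%MS -> codim_le 1 y.
Proof.
move=> yx yA m md im.
have := in_flat_ext Fk (carrier_self T x) Af AF (carrier_sub yx) (carrier_self T y) yA im.
by move: md; rewrite dk; lia.
Qed.

Lemma homothety_off (z : 'rV[R]_d) h : h != 0 -> ~~ (z - x <= A)%MS -> ~~ (pt x z h - x <= A)%MS.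
Proof.
move=> h0; apply: contra; rewrite /pt addrAC subrr add0r => H.
by rewrite -[z - x](scalerK h0) scalemx_sub.
Qed.

Lemma hyperface_off (H : set 'rV[R]_d) : H x -> affine_dim k.+1 H ->
  exists2 z, H z & ~~ (z - x <= A)%MS.
Proof.
move=> Hx Hk; apply: contrapT => nz.
have : in_flat k H.
  exists x, A => e He; apply: contrapT => /negP eA; apply: nz; by exists e.
by move=> /(affine_dim_leq Hk)/(_ (@subset_refl _ _)); rewrite ltnn.
Qed.

Lemma near_hyperface_off (C : set 'rV[R]_d) :
  (forall a b t, C a -> C b -> 0 <= t -> t <= 1 -> C (pt a b t)) ->
  C x -> affine_dim k.+1 C ->
  exists z, [/\ C z, (forall P, T P -> P z -> P x) & ~~ (z - x <= A)%MS].
Proof.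
move=> Cv Cx Ck; have [z Cz zA] := hyperface_off Cx Ck.
have [h /andP[h0 h1] Hh] := near_homothety (@compact_set1 _ z) (near_star T_tiling T_locfin x).
exists (pt x z h); split.
- by apply: Cv => //; exact: ltW.
- exact: Hh.
- by apply: homothety_off => //; rewrite gt_eqF.
Qed.

Lemma adj_dim P Q : adj P Q -> affine_dim k.+1 (P `&` Q).
Proof. by move=> /adjacent_cap[//|//|m [dm Hm _ _ _]]; have -> : k.+1 = m by lia. Qed.

Lemma adj_near_off P Q : adj P Q -> P x -> Q x -> exists z,
  [/\ P z, Q z, (forall P, T P -> P z -> P x), ~~ (z - x <= A)%MS & codim_le 1 z].
Proof.
move=> PQa Px Qx; have [TP TQ _ _] := PQa.
have [||z [[Pz Qz] zx zA]] := @near_hyperface_off (P `&` Q) _ _ (adj_dim PQa) => //.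
  by move=> a b t [Pa Qa] [Pb Qb] t0 t1; split; apply: (cell_convex T_tiling).
by exists z; split=> //; exact: off_face_cod1.
Qed.

(** The functionals that separate P from three neighbours contradict
    three_functionals, evaluated at points of the common hyperfaces off the hull of
    the carrier. *)
Lemma at_most_two_neighbours P Q1 Q2 Q3 : adj P Q1 -> adj P Q2 -> adj P Q3 ->
  P x -> Q1 x -> Q2 x -> Q3 x -> [\/ Q1 = Q2, Q1 = Q3 | Q2 = Q3].
Proof.
move=> a1 a2 a3 Px Q1x Q2x Q3x.
have [?|n12] := pselect (Q1 = Q2); first by constructor 1.
have [?|n13] := pselect (Q1 = Q3); first by constructor 2.
have [?|n23] := pselect (Q2 = Q3); first by constructor 3.
have strict Q Q' z w : adj P Q -> adj P Q' -> Q <> Q' -> P z -> Q' z -> codim_le 1 z ->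
    (forall y, P y -> dotp w y <= dotp w x) ->
    (forall y, P y -> (Q y <-> dotp w y = dotp w x)) -> dotp w (z - x) < 0.
  move=> [TP TQ PQ _] [_ TQ' PQ' _] QQ' Pz Q'z cz wP wQ.
  rewrite dotpBr subr_lt0 lt_neqAle wP// andbT; apply/eqP => /(wQ _ Pz) Qz.
  by have [] := cod1_two_cells T_tiling T_normal T_locfin cz TP TQ TQ' Pz Qz Q'z.
have [z1 [Pz1 Qz1 _ _ c1]] := adj_near_off a1 Px Q1x.
have [z2 [Pz2 Qz2 _ _ c2]] := adj_near_off a2 Px Q2x.
have [z3 [Pz3 Qz3 _ _ c3]] := adj_near_off a3 Px Q3x.
have [TP T1 P1 _] := a1; have [_ T2 P2 _] := a2; have [_ T3 P3 _] := a3.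
have [w1 [_ w1P w1Q w1F]] := cap_functional T_tiling T_normal TP T1 P1 Px Q1x.
have [w2 [_ w2P w2Q w2F]] := cap_functional T_tiling T_normal TP T2 P2 Px Q2x.
have [w3 [_ w3P w3Q w3F]] := cap_functional T_tiling T_normal TP T3 P3 Px Q3x.
have zero Q w z : (forall y, P y -> (Q y <-> dotp w y = dotp w x)) -> P z -> Q z ->
    dotp w (z - x) = 0.
  by move=> H Pz Qz; rewrite dotpBr (iffLR (H _ Pz) Qz) subrr.
exfalso; apply: (@three_functionals R d k A w1 w2 w3 (z1 - x) (z2 - x) (z3 - x) Af dk (AF w1F) (AF w2F) (AF w3F)).
- exact: (zero Q1).
- exact: (zero Q2).
- exact: (zero Q3).
- exact: (strict Q1 Q2).
- exact: (strict Q1 Q3).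
- by apply: (strict Q2 Q1) => //; exact: nesym.
- exact: (strict Q2 Q3).
- by apply: (strict Q3 Q1) => //; exact: nesym.
- by apply: (strict Q3 Q2) => //; exact: nesym.
Qed.

(** If no other cell contained a point of H close to x and off the hull of the
    carrier, P would contain a neighbourhood of that point and cross H. *)
Lemma facet_neighbour P H : T P -> hyperface d H P -> carrier x `<=` H ->
  exists Q, [/\ adj P Q, Q x & H = P `&` Q].
Proof.
move=> TP HP FH; have Hx : H x by exact: FH.
have [m dm [[_ [v [c [vP HE]]]] Hm]] := HP.
have HsP z : H z -> P z by rewrite HE => -[].
have Hv z : H z -> dotp v z = c by rewrite HE => -[].
have Hc a b t : H a -> H b -> 0 <= t -> t <= 1 -> H (pt a b t).
  rewrite HE => -[Pa va] [Pb vb] t0 t1; split; first exact: (cell_convex T_tiling).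
  by rewrite /= dotp_pt va vb subrr mulr0 addr0.
have Hk : affine_dim k.+1 H by have -> : k.+1 = m by lia.
have [h [Hh hx hA]] := near_hyperface_off Hc Hx Hk.
have ch := off_face_cod1 hx hA.
have v0 : v != 0.
  apply/eqP => v0; have HP' : H = P.
    apply/seteqP; split=> z; first exact: HsP.
    by move=> Pz; rewrite HE; split=> //=; rewrite -(Hv _ Hx) v0 !dotp0l.
  by have := affine_dim_uniq Hm; rewrite HP' => /(_ _ (cell_dim T_tiling TP)); lia.
have [Q [TQ Qh QP]] : exists Q, [/\ T Q, Q h & Q <> P].
  apply: contrapT => nQ.
  have [r /andP[r0 r1] Hr] := near_homothety (@compact_set1 _ (h + v)) (near_star T_tiling T_locfin h).
  have [Q TQ Qr] := cell_cover T_tiling (pt h (h + v) r).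
  have Qh : Q h by exact: (Hr _ erefl).
  have QP : Q = P by apply: contrapT => QP; apply: nQ; exists Q.
  have := vP _ (eq_ind _ (fun S => S _) Qr _ QP).
  rewrite dotp_pt dotpDr (Hv _ Hh) [_ + _ - _]addrAC subrr add0r gerDl.
  by rewrite leNgt mulr_gt0// dotp_gt0.
exists Q; have aPQ : adj P Q.
  by apply: (cod1_adjacent T_tiling T_normal ch) => //; [exact: HsP | exact: nesym].
split=> //; first exact: hx.
have [_ _ PQ _] := aPQ.
apply: (hyperface_cap T_tiling T_normal TP TQ PQ HP Hx); first exact: hx.
move=> l ld il.
have Qx : Q x by exact: hx.
suff : (k < l)%N by move: ld; rewrite dk; lia.
apply: (in_flat_ext Fk (carrier_self T x) Af AF _ _ hA il); last by [].
by move=> z Fz; split; [exact: FH | exact: Fz].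
Qed.

(** The segment from p to x + e, shrunk towards x, starts in P and ends outside P,
    on the supporting hyperplane of the carrier. It misses the hull of the carrier,
    so P has an adjacent cell at the point where it leaves P. *)
Lemma exit_neighbour P p w e : T P -> P x -> P p -> codim_le 0 p ->
  (forall y, P y -> dotp w y <= dotp w x) ->
  (forall y, P y -> dotp w y = dotp w x -> carrier x y) ->
  (forall y, carrier x y -> dotp w y = dotp w x) ->
  dotp w e = 0 -> ~~ (e <= A)%MS -> dotp w p < dotp w x ->
  exists Q t h, [/\ adj P Q /\ Q x, 0 < t < 1, 0 < h <= 1 &
    P (pt x (pt p (x + e) t) h) /\ Q (pt x (pt p (x + e) t) h)].
Proof.
move=> TP Px Pp cp wP wF Fw we eA wp.
have [h /andP[h0 h1] Hh] := near_homothety (@segment_set_compact _ d p (x + e)) (near_star T_tiling T_locfin x).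
pose y t := pt x (pt p (x + e) t) h.
have ynear t : 0 <= t <= 1 -> forall Q, T Q -> Q (y t) -> Q x.
  by move=> t01; apply: Hh; exists t => //=; rewrite in_itv.
have y0 : P (y 0) by rewrite /y pt0; apply: (cell_convex T_tiling) => //; exact: ltW.
have y1 : ~ P (y 1).
  rewrite /y pt1 => Py.
  have /FA : carrier x (pt x (x + e) h).
    by apply: wF => //; rewrite dotp_pt dotpDr we; ring.
  apply/negP; apply: homothety_off; first by rewrite gt_eqF.
  by rewrite addrAC subrr add0r.
have yoff t : 0 <= t <= 1 -> ~~ (y t - x <= A)%MS.
  move=> /andP[t0 t1]; apply: homothety_off; first by rewrite gt_eqF.
  have [->|tn1] := eqVneq t 1; first by rewrite pt1 addrAC subrr add0r.
  have wA := AF Fw.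
  apply/negP => /(sub_dotp0 wA)/eqP; apply/negP.
  rewrite dotpBr dotp_pt dotpDr we; have tl1 : t < 1 by rewrite lt_neqAle tn1.
  rewrite lt_eqF//; nra.
have [[t [Q [t01 Py TQ Qy QP]]]|nQ] := pselect (exists t Q,
    [/\ 0 <= t <= 1, P (y t), T Q, Q (y t) & Q <> P]).
  exists Q, t, h; split=> //; last by rewrite h0.
    split; last exact: (ynear t).
    have ct := off_face_cod1 (ynear t t01) (yoff t t01).
    by apply: (cod1_adjacent T_tiling T_normal ct) => //; exact: nesym.
  move: t01 => /andP[t0 t1]; rewrite !lt_neqAle t0 t1 !andbT; apply/andP; split.
    apply/eqP => tz; subst t; apply: QP; move: Qy; rewrite /y pt0 => Qy.
    apply: (cod0_uniq T_tiling T_normal cp) => //.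
    have [hE|hn] := eqVneq h 1; first by move: Qy; rewrite hE pt1.
    have hl : h < 1 by rewrite lt_neqAle hn.
    by have [] := cell_extremal T_tiling T_normal TP TQ Px Pp h0 hl Qy.
  by apply/eqP => tz; subst t; exact: y1.
case: y1; apply: (@unit_interval_ind R (fun t => P (y t))) => //; last by rewrite ler01 lexx.
move=> t t01.
have N : \forall t' \near t, forall Q, T Q -> Q (y t') -> Q (y t).
  have yE : y = pt (pt x p h) (pt x (x + e) h) by apply/funext => r; rewrite /y pt_homothety.
  rewrite yE; exact: (@pt_continuous R d _ _ t _ (near_star T_tiling T_locfin _)).
apply: filterS N => t' H t'01; split=> Py; last exact: H.
have [Q TQ Qy'] := cell_cover T_tiling (y t').
suff <- : Q = P by [].
by apply: contrapT => QP; apply: nQ; exists t, Q; split=> //; exact: H.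
Qed.

(** A functional w cuts the carrier out of P; P is left on its two sides by heading
    for x + e and x - e with e in the kernel of w. If both exits led to the same
    cell Q, then Q would contain points of the open segment from x to p, where p
    is a point of P in no other cell. *)
Lemma two_neighbours P : T P -> P x ->
  exists Q1 Q2, [/\ Q1 <> Q2, adj P Q1 /\ Q1 x & adj P Q2 /\ Q2 x].
Proof.
move=> TP Px.
have [_ [w [c [wPc FE]]]] := face_carrier T_normal T_locfin TP Px.
have cE : c = dotp w x by have := carrier_self T x; rewrite FE => -[].
rewrite cE in wPc FE.
have wF y : P y -> dotp w y = dotp w x -> carrier x y by move=> Py wy; rewrite FE.
have Fw y : carrier x y -> dotp w y = dotp w x by rewrite FE => -[].
have [e we eA] : exists2 e : 'rV[R]_d, dotp w e = 0 & ~~ (e <= A)%MS.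
  apply: contrapT => H.
  have : (kermx w^T <= A)%MS.
    apply/rV_subP => e /sub_kermxP ew; apply: contrapT => /negP eA; apply: H.
    by exists e => //; rewrite dotpC dotpE ew mxE.
  move=> /mxrankS; rewrite mxrank_ker (eqP Af) mxrank_tr.
  by have := rank_leq_row w; have := dk; lia.
have [p Pp cp] := generic_cod0 T_locfin (cell_convex T_tiling TP) (cell_dim T_tiling TP)
  (cell_compact T_tiling TP) (@subset_refl _ _).
have wp : dotp w p < dotp w x.
  rewrite lt_neqAle wPc// andbT; apply/eqP => /(wF _ Pp) Fp.
  have PF : P `<=` carrier x.
    move=> y Py Q TQ Qx; have -> : Q = P by apply: (cod0_uniq T_tiling T_normal cp) => //; exact: Fp.
    by [].
  have := affine_dim_leq (cell_dim T_tiling TP) (affine_dim_in_flat Fk) PF.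
  by rewrite dk; lia.
have we' : dotp w (- e) = 0 by rewrite dotpNr we oppr0.
have eA' : ~~ (- e <= A)%MS by rewrite eqmx_opp.
have [Q1 [t1 [h1 [[aPQ1 Q1x] t01 h01 [Py1 Qy1]]]]] := exit_neighbour TP Px Pp cp wPc wF Fw we eA wp.
have [Q2 [t2 [h2 [[aPQ2 Q2x] t02 h02 [Py2 Qy2]]]]] := exit_neighbour TP Px Pp cp wPc wF Fw we' eA' wp.
exists Q1, Q2; split=> // Q12; subst Q2.
have [_ TQ1 PQ1 _] := aPQ1.
move: t01 t02 h01 h02 => /andP[t10 t11] /andP[t20 t21] /andP[h10 h11] /andP[h20 h21].
(* With weights h2 * t2 and h1 * t1 the components along e of the two exit points
   cancel; their mean is pt x p r. *)
pose D := h1 * t1 + h2 * t2.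
have D1 : 0 < h1 * t1 by apply: mulr_gt0.
have D2 : 0 < h2 * t2 by apply: mulr_gt0.
have D0 : 0 < D by apply: addr_gt0.
pose r := h1 * h2 * (t2 * (1 - t1) + t1 * (1 - t2)) / D.
have N0 : 0 < h1 * h2 * (t2 * (1 - t1) + t1 * (1 - t2)).
  by apply: mulr_gt0; [exact: mulr_gt0 | apply: addr_gt0; apply: mulr_gt0 => //; rewrite subr_gt0].
have r0 : 0 < r by apply: divr_gt0.
have r1 : r < 1.
  rewrite ltr_pdivrMr// mul1r /D.
  have B1 : h1 * h2 * (t2 * (1 - t1)) < h2 * t2.
    have -> : h1 * h2 * (t2 * (1 - t1)) = (h2 * t2) * (h1 * (1 - t1)) by ring.
    by rewrite gtr_pMr//; nra.
  have B2 : h1 * h2 * (t1 * (1 - t2)) < h1 * t1.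
    have -> : h1 * h2 * (t1 * (1 - t2)) = (h1 * t1) * (h2 * (1 - t2)) by ring.
    by rewrite gtr_pMr//; nra.
  by rewrite mulrDr addrC; apply: ltrD.
have Qr : Q1 (pt x p r).
  have := cell_convex T_tiling TQ1 Qy1 Qy2 (t := h1 * t1 / D).
  have -> : pt (pt x (pt p (x + e) t1) h1) (pt x (pt p (x - e) t2) h2) (h1 * t1 / D) = pt x p r.
    apply/rowP => j; rewrite !mxE /r /D; field.
    by rewrite -/D gt_eqF.
  apply; first by apply: divr_ge0; exact: ltW.
  by rewrite ler_pdivrMr// mul1r /D lerDl ltW.
have [_ Qp] := cell_extremal T_tiling T_normal TP TQ1 Px Pp r0 r1 Qr.
by apply: PQ1; apply: (cod0_uniq T_tiling T_normal cp).
Qed.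

End AtFace.

(** The adjacency graph of the cells around x is connected and every cell has two
    neighbours, so it is a cycle. Its hyperfaces are all those containing the
    carrier, which makes the cycle an instance of around. *)
Lemma codim2_potential (W : zmodType) (J : set 'rV[R]_d -> set 'rV[R]_d -> W) x k :
  d = k.+2 -> affine_dim k (carrier x) ->
  (forall P Q, adj P Q -> J Q P = - J P Q) ->
  (forall m (C G : 'I_m -> set 'rV[R]_d), around T (carrier x) C G ->
     (forall i, G i = C i `&` C (ordS i)) -> (forall i, adj (C i) (C (ordS i))) ->
     \sum_i J (C i) (C (ordS i)) = 0) ->
  exists a, forall P Q, adj P Q -> P x -> Q x -> a Q - a P = J P Q.
Proof.
move=> dk Fk JC Jsum.
have [A [Af FA AF]] := affine_dim_at Fk (carrier_self T x).
pose e P Q := [/\ adj P Q, P x & Q x].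
have [P0 TP0 P0x] := cell_cover T_tiling x.
have [||||||||m [C [CI CSS Ce eC]]] := @cycle_graph _ [set P | T P /\ P x] e.
- exact: star_finite.
- by exists P0.
- by move=> P Q [[TP TQ _ _] Px Qx].
- by move=> P Q [/adjC aQP Px Qx].
- by move=> P [[_ _ + _] _ _]; exact.
- move=> P [TP Px]; have [Q1 [Q2 [Q12 [a1 Q1x] [a2 Q2x]]]] := two_neighbours dk Fk Af FA AF TP Px.
  by exists Q1, Q2.
- move=> P Q1 Q2 Q3 [a1 Px Q1x] [a2 _ Q2x] [a3 _ Q3x].
  exact: (at_most_two_neighbours dk Fk Af AF a1 a2 a3).
- move=> B [Q [BQ [TQ Qx]]] HB P [TP Px].
  apply: (star_connected T_tiling T_normal T_locfin (x := x) (E := fun A B' => B A -> B B') _ _ _ TQ TP Qx Px BQ) => //.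
    by move=> A1 A2 A3 _ _ _ _ _ _ H1 H2 /H1.
  by move=> A1 A2 A1x A2x aA BA1; apply: (HB A1).
pose G i := C i `&` C (ordS i).
have aC i : adj (C i) (C (ordS i)) by have [] := Ce i.
have Cx i : C i x by have [] := Ce i.
have aroundC : around T (carrier x) C G.
  split.
  - move=> i j; rewrite /G => Gij.
    have [y [y1 y2 Fy cy]] := adjacent_relint T_tiling T_normal T_locfin (aC i).
    have Cjy : (C j `&` C (ordS j)) y by rewrite -Gij.
    have [TCi TCi' Ci _] := aC i; have [TCj TCj' Cj _] := aC j.
    have two := cod1_two_cells T_tiling T_normal T_locfin cy.
    have [//|/CI//|E] := two _ _ _ TCi TCi' TCj y1 y2 Cjy.1.
    have [//|E'|E'] := two _ _ _ TCi TCi' TCj' y1 y2 Cjy.2.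
      by case: (CSS i); apply: (CI); rewrite E'; congr (C (ordS _)); apply: CI.
    by case: Cj; rewrite -E -E'.
  - move=> H; split=> [[[P TP HP] FH]|[i ->]].
      have HsP : H `<=` P by case: HP => l _ [[_ [v [c [_ ->]]]] _] z [].
      have Px : P x by apply: HsP; exact: FH.
      have [Q [aPQ Qx ->]] := facet_neighbour dk Fk Af AF TP HP FH.
      have [|i [[-> ->]|[-> ->]]] := eC P Q; first by split.
        by exists i.
      by exists i; rewrite setIC.
    split; last by move=> z Fz; have [T1 T2 _ _] := aC i; split; apply: Fz.
    have [TCi _ _ _] := aC i; exists (C i) => //.
    by have [l [_ _ + _ _]] := adjacent_cap T_tiling T_normal (aC i).
  - move=> i; have [TCi TCi' Ci _] := aC i; split=> //.
      by have [l [_ _ + _ _]] := adjacent_cap T_tiling T_normal (aC i).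
    by have [l [_ _ _ + _]] := adjacent_cap T_tiling T_normal (aC i).
have [a Ha] := cycle_potential CI (Jsum _ _ _ aroundC (fun=> erefl) aC).
exists a => P Q aPQ Px Qx; have [|i [[-> ->]|[-> ->]]] := eC P Q; first by split.
  exact: Ha.
by rewrite (JC _ _ (aC i)) -(Ha i) opprB.
Qed.

(** Codimension at most one leaves at most two cells around x, and a single jump
    always has a potential. *)
Lemma local_potential (W : zmodType) (J : set 'rV[R]_d -> set 'rV[R]_d -> W) x :
  (forall P Q, adj P Q -> J Q P = - J P Q) ->
  (forall k, d = k.+2 -> affine_dim k (carrier x) ->
   forall m (C G : 'I_m -> set 'rV[R]_d), around T (carrier x) C G ->
     (forall i, G i = C i `&` C (ordS i)) -> (forall i, adj (C i) (C (ordS i))) ->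
     \sum_i J (C i) (C (ordS i)) = 0) ->
  codim_le 2 x -> exists a, forall P Q, adj P Q -> P x -> Q x -> a Q - a P = J P Q.
Proof.
move=> JC Jsum c2; have [k Fk Hk] := carrier_dim T x.
have := Hk _ c2; rewrite addn2 leq_eqVlt => /orP[/eqP dk|].
  exact: (codim2_potential dk Fk JC (Jsum k dk Fk)).
rewrite ltnS => dk1.
have c1 : codim_le 1 x.
  by move=> l ld il; have := affine_dim_leq Fk il (@subset_refl _ _); lia.
have [P0 TP0 P0x] := cell_cover T_tiling x.
exists (fun P => if pselect (P = P0) then 0 else J P0 P) => P Q aPQ Px Qx.
have [TP TQ PQ _] := aPQ.
case: pselect => [QP0|nQ]; case: pselect => [PP0|nP] /=.
- by case: PQ; rewrite PP0.
- by rewrite sub0r QP0 -JC// -QP0; exact: adjC.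
- by rewrite subr0 PP0.
- by have [] := cod1_two_cells T_tiling T_normal T_locfin c1 TP0 TP TQ P0x Px Qx => // E; [case: nP | case: nQ].
Qed.

End Codim2.

(** * From local to global potentials *)

Section Monodromy.
Context {R : realType} {d : nat} (T : set (set 'rV[R]_d)).
Hypothesis T_tiling : tiling T.
Hypothesis T_normal : normal_tiling T.
Hypothesis T_locfin : locally_finite T.
Implicit Types (P Q S : set 'rV[R]_d) (y z w : 'rV[R]_d).
Local Notation adj := (Defs.adjacent d T).
Local Notation codim_le := (codim_le T).
Context (W : zmodType) (J : set 'rV[R]_d -> set 'rV[R]_d -> W).
Hypothesis J_local : forall x, codim_le 2 x ->
  exists a, forall P Q, adj P Q -> P x -> Q x -> a Q - a P = J P Q.

Definition potential_at (a : set 'rV[R]_d -> W) z :=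
  forall P Q, adj P Q -> P z -> Q z -> a Q - a P = J P Q.

(** Cells around z are connected through hyperfaces at which both potentials have
    the same jump. *)
Lemma potential_diff a b z P Q : potential_at a z -> potential_at b z ->
  T P -> T Q -> P z -> Q z -> a P - b P = a Q - b Q.
Proof.
move=> az bz TP TQ Pz Qz.
apply: (star_connected T_tiling T_normal T_locfin (x := z)
  (E := fun A B => a A - b A = a B - b B)) => //.
  by move=> A B C _ _ _ _ _ _ -> ->.
move=> A B Az Bz aAB; have := az _ _ aAB Az Bz; rewrite -(bz _ _ aAB Az Bz) => E.
have -> : a B = b B - b A + a A by rewrite -E subrK.
by rewrite [RHS]addrAC [b B - b A - b B]addrAC subrr add0r addrC.
Qed.

Context (P0 : set 'rV[R]_d) (x0 : 'rV[R]_d).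
Hypothesis TP0 : T P0.
Hypothesis P0x : P0 x0.
Hypothesis c0 : codim_le 0 x0.

Definition potential_on (a : set 'rV[R]_d -> W) y (r : R) :=
  forall t, 0 <= t <= r -> potential_at a (pt x0 y t).

Definition good y := forall t : R, 0 <= t <= 1 -> codim_le 2 (pt x0 y t).

(** Continue the potential along the segment. To pass to a point y_r from an earlier
    one close to it, glue with a local potential at y_r, after adding a constant
    which potential_diff makes the same for all cells met before. *)
Lemma segment_potential y : good y -> exists a, potential_on a y 1.
Proof.
move=> gy; apply: (@unit_interval_ind R (fun r => exists a, potential_on a y r)); last first.
- by rewrite ler01 lexx.
- move=> r r01.
  have := @pt_continuous R d x0 y r _ (near_star T_tiling T_locfin (pt x0 y r)).
  move=> /nbhs_ballP[e /= e0 He].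
  have {}He t : `|r - t| < e -> forall P, T P -> P (pt x0 y t) -> P (pt x0 y r).
    by move=> rt; exact: (He t).
  apply/nbhs_ballP; exists e => //= r' rr' r'01.
  rewrite /ball/= in rr'.
  split=> -[a Ha].
    exists a => t /andP[t0 tr']; have [tr|rt] := lerP t r; first by apply: Ha; rewrite t0.
    have te : `|r - t| < e.
      apply: le_lt_trans rr'; rewrite !ltr0_norm ?subr_lt0//; last exact: lt_le_trans rt tr'.
      by rewrite lerN2 lerB.
    move=> P Q aPQ Pt Qt; have [TP TQ _ _] := aPQ.
    apply: (Ha r); rewrite ?lexx ?andbT//; first by case/andP: r01.
      exact: (He t).
    exact: (He t).
  have [rr|r'r] := lerP r r'.
    by exists a => t /andP[t0 tr]; apply: Ha; rewrite t0 (le_trans tr).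
  have te t : r' <= t <= r -> `|r - t| < e.
    move=> /andP[r't tr]; apply: le_lt_trans rr'.
    by rewrite !ger0_norm ?subr_ge0 ?lerB// ltW.
  have [b Hb] := J_local (gy r r01).
  have [P1 TP1 P1r'] := cell_cover T_tiling (pt x0 y r').
  have r'0 : 0 <= r' by case/andP: r'01.
  have ar' : potential_at a (pt x0 y r') by apply: Ha; rewrite r'0 lexx.
  have br' : potential_at b (pt x0 y r').
    move=> P Q aPQ Pt Qt; have [TP TQ _ _] := aPQ.
    by apply: Hb => //; apply: (He r') => //; apply: te; rewrite lexx ltW.
  (* Cells met up to r' keep their value; the others contain y_r. *)
  pose a' P := if pselect (exists2 t, 0 <= t <= r' & P (pt x0 y t)) then a P else b P + (a P1 - b P1).
  have a'1 t P : 0 <= t <= r' -> P (pt x0 y t) -> a' P = a P.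
    by move=> tr' Pt; rewrite /a'; case: pselect => // -[]; exists t.
  have a'2 t P : r' <= t -> T P -> P (pt x0 y t) -> a' P = b P + (a P1 - b P1).
    move=> r't TP Pt; rewrite /a'; case: pselect => // -[t0 /andP[t00 t0r'] Pt0] /=.
    have Pr' : P (pt x0 y r').
      have [E|tn] := eqVneq t0 t; first by have -> : r' = t0 by apply/eqP; rewrite eq_le t0r' andbT E.
      have tt : 0 < t - t0 by rewrite subr_gt0 lt_neqAle tn (le_trans t0r').
      have := cell_convex T_tiling TP Pt0 Pt (t := (r' - t0) / (t - t0)).
      rewrite pt_pt mulfVK ?gt_eqF// [t0 + _]addrC subrK; apply.
        by apply: divr_ge0; [rewrite subr_ge0 | exact: ltW].
      by rewrite ler_pdivrMr// mul1r lerB.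
    by rewrite (potential_diff ar' br' TP1 TP P1r' Pr') addrC subrK.
  exists a' => t /andP[t0 tr] P Q aPQ Pt Qt; have [TP TQ _ _] := aPQ.
  have [tr'|r't] := lerP t r'.
    rewrite (a'1 t P) ?t0// (a'1 t Q) ?t0//.
    by apply: (Ha t) => //; rewrite t0.
  rewrite (a'2 t P) ?ltW// (a'2 t Q) ?ltW//.
  rewrite opprD addrACA subrr addr0; apply: Hb => //; apply: (He t) => //; apply: te; rewrite tr ltW//.
- have unit01 : (0 : R) <= (0 : R) <= (1 : R) by rewrite lexx ler01.
  have [a Ha] := J_local (gy 0 unit01).
  by exists a => t; rewrite -eq_le => /eqP <-.
Qed.

(** A relation rather than a function: potentials along the segment are determined
    only on the cells that meet it. *)
Definition value y Q v := exists2 a, potential_on a y 1 & a P0 = 0 /\ a Q = v.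

Lemma value_ex a y Q : potential_on a y 1 -> value y Q (a Q - a P0).
Proof.
move=> Ha; exists (fun P => a P - a P0); last by rewrite subrr.
move=> t t01 P S aPS Pt St.
by rewrite opprB addrA subrK; exact: (Ha t).
Qed.

Lemma value_uniq y Q v v' : T Q -> Q y -> value y Q v -> value y Q v' -> v = v'.
Proof.
move=> TQ Qy [a Ha [a0 <-]] [b Hb [b0 <-]].
suff : a P0 - b P0 = a Q - b Q.
  by rewrite a0 b0 subr0 => /esym/eqP; rewrite subr_eq0 => /eqP.
apply: (segment_cells T_tiling T_locfin (E := fun A B => a A - b A = a B - b B) (p := x0) (q := y)) => //.
  by move=> A B C _ _ _ -> ->.
move=> t A B t01 TA TB At Bt.
by apply: (@potential_diff a b (pt x0 y t)) => //; [exact: Ha | exact: Hb].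
Qed.

(** As the end of the segment moves from y to w inside Q, a potential along one
    segment remains one along all nearby segments, since cells met by these are met
    at a nearby point of the first. So the value does not move. *)
Lemma value_triangle y w Q v : T Q -> Q y -> Q w ->
  (forall t r, 0 <= t <= 1 -> 0 <= r <= 1 -> codim_le 2 (pt x0 (pt y w t) r)) ->
  value y Q v -> value w Q v.
Proof.
move=> TQ Qy Qw gtri vy.
suff : value (pt y w 1) Q v by rewrite pt1.
apply: (@unit_interval_ind R (fun t => value (pt y w t) Q v)); last by rewrite ler01 lexx.
  by rewrite pt0.
move=> t t01.
have Qt s : 0 <= s <= 1 -> Q (pt y w s).
  by move=> /andP[s0 s1]; apply: (cell_convex T_tiling).
have [a Ha] := segment_potential (fun r => gtri t r t01).
pose I := `[0, 1]%classic : set R.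
have tube : \forall t' \near t, I `<=` [set r' | exists2 r, 0 <= r <= 1 &
    forall P, T P -> P (pt x0 (pt y w t') r') -> P (pt x0 (pt y w t) r)].
  have /compact_near_coveringP Ic : compact I by exact: segment_compact.
  apply: (Ic R (nbhs t) (fun t' r' => exists2 r, 0 <= r <= 1 &
    forall P, T P -> P (pt x0 (pt y w t') r') -> P (pt x0 (pt y w t) r))) => r Ir.
  have [[A B] [/= rA tB] AB] := @pt_continuous2 R d x0 (r, pt y w t) _ (near_star T_tiling T_locfin (pt x0 (pt y w t) r)).
  exists (A, pt y w @^-1` B); first by split=> //=; exact: (@pt_continuous R d y w t _ tB).
  move=> [r' t'] [/= Ar' Bt']; exists r; first by move: Ir; rewrite /I/= in_itv.
  by have := AB (r', pt y w t') (conj Ar' Bt').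
apply: filterS tube => t' Ht' t'01.
have Ha' : potential_on a (pt y w t') 1.
  move=> r' r'01 P S aPS Pr Sr; have [TP TS _ _] := aPS.
  have [|r r01 Hr] := Ht' r'; first by rewrite /I/= in_itv.
  by apply: (Ha r r01) => //; exact: Hr.
split=> [vt|vt].
  rewrite (value_uniq TQ (Qt _ t01) vt (value_ex Q Ha)); exact: value_ex.
rewrite (value_uniq TQ (Qt _ t'01) vt (value_ex Q Ha')); exact: value_ex.
Qed.

Definition cone Q := (fun tz : R * 'rV[R]_d => pt x0 tz.2 tz.1) @` (`[0, 1]%classic `*` Q).

Lemma cone_compact Q : T Q -> compact (cone Q).
Proof.
move=> TQ; apply: continuous_compact.
  by apply: continuous_subspaceT; exact: pt_continuous2.
by apply: compact_setX; [exact: segment_compact | exact: (cell_compact T_tiling)].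
Qed.

Lemma cone_in Q y t : Q y -> 0 <= t <= 1 -> cone Q (pt x0 y t).
Proof. by move=> Qy t01; exists (t, y) => //; split=> //=; rewrite in_itv. Qed.

Lemma base_codim2 : codim_le 2 x0.
Proof. by move=> k kd; apply: c0; move: kd; lia. Qed.

Lemma good_point (C : set 'rV[R]_d) m Q : T Q -> C `<=` Q ->
  (forall x y t, C x -> C y -> 0 <= t -> t <= 1 -> C (pt x y t)) ->
  affine_dim m C -> (d <= m + 1)%N -> exists2 y, C y & good y.
Proof.
move=> TQ CQ Cv Cm dm.
have [|y Cy Hy] := generic_point T_locfin (c := 2) (ess := [:: [:: x0]]) Cv Cm (cone_compact TQ).
  by move=> es; rewrite inE => /eqP ->; move: dm => /=; lia.
exists y => // t t01; apply: (segment_cod base_codim2).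
by apply: Hy; [exact: mem_head | apply: cone_in => //; exact: CQ].
Qed.

(** Choose w in Q so generic that the triangles x0, y, w and x0, y', w avoid the
    skeleton of codimension 3: the joins of its flats with an edge have dimension
    below d. *)
Lemma value_indep Q y y' v v' : T Q -> Q y -> Q y' -> good y -> good y' ->
  value y Q v -> value y' Q v' -> v = v'.
Proof.
move=> TQ Qy Qy' gy gy' vy vy'.
have [|w Qw Hw] := generic_point T_locfin (c := 2) (ess := [:: [:: x0; y]; [:: x0; y']])
    (cell_convex T_tiling TQ) (cell_dim T_tiling TQ) (cone_compact TQ).
  by move=> es; rewrite !inE => /orP[]/eqP -> /=; lia.
have tri u : Q u -> good u -> [:: x0; u] \in [:: [:: x0; y]; [:: x0; y']] ->
    forall t r, 0 <= t <= 1 -> 0 <= r <= 1 -> codim_le 2 (pt x0 (pt u w t) r).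
  move=> Qu gu us t r t01 r01; set z := pt x0 _ r; apply: contrapT => nz.
  have Qt : Q (pt u w t) by case/andP: t01 => t0 t1; apply: (cell_convex T_tiling).
  apply: (Hw _ z us _ nz); first exact: cone_in.
  have r0 : r != 0 by apply/eqP => r0; apply: nz; rewrite /z r0 pt0; exact: base_codim2.
  have t0 : t != 0 by apply/eqP => t0; apply: nz; rewrite /z t0 pt0; exact: gu.
  apply: (@aff_hull_pt _ _ _ u w t _ _ t0).
    by apply: sub_aff_hull; right; rewrite /= !inE eqxx orbT.
  apply: (@aff_hull_pt _ _ _ x0 (pt u w t) r _ _ r0).
    by apply: sub_aff_hull; right; rewrite /= !inE eqxx.
  by apply: sub_aff_hull; left; exact: carrier_self.
have v1 := value_triangle TQ Qy Qw (tri y Qy gy (mem_head _ _)) vy.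
have us' : [:: x0; y'] \in [:: [:: x0; y]; [:: x0; y']] by rewrite !inE eqxx orbT.
have v2 := value_triangle TQ Qy' Qw (tri y' Qy' gy' us') vy'.
exact: value_uniq TQ Qw v1 v2.
Qed.

Lemma based_global_potential : exists a, forall P Q, adj P Q -> a Q - a P = J P Q.
Proof.
have /choice[a Ha] : forall Q, exists v, T Q -> exists2 y, Q y & good y /\ value y Q v.
  move=> Q; have [TQ|nTQ] := pselect (T Q); last by exists 0.
  have [|y Qy gy] := good_point TQ (@subset_refl _ _) (cell_convex T_tiling TQ) (cell_dim T_tiling TQ).
    by lia.
  have [b Hb] := segment_potential gy.
  by exists (b Q - b P0) => _; exists y => //; split=> //; exact: value_ex.
exists a => P Q aPQ; have [TP TQ _ _] := aPQ.
have [m [dm Hm _ _ _]] := adjacent_cap T_tiling T_normal aPQ.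
have [|||y [Py Qy] gy] := @good_point (P `&` Q) m P TP _ _ Hm.
- by move=> z [].
- by move=> u z t [Pu Qu] [Pz Qz] t0 t1; split; apply: (cell_convex T_tiling).
- by lia.
have [b Hb] := segment_potential gy.
have val S : T S -> S y -> a S = b S - b P0.
  move=> TS Sy; have [z Sz [gz vz]] := Ha S TS.
  by apply: (value_indep TS Sz Sy gz gy vz); exact: value_ex.
rewrite (val Q)// (val P)// opprB addrA subrK.
by apply: (Hb 1); rewrite ?ler01 ?lexx// pt1.
Qed.

End Monodromy.

(** Values at a cell of potentials along good segments from a base point do not
    depend on the segment, and adjacent cells share the end of a good segment. *)
Theorem global_potential (R : realType) (d : nat) (T : set (set 'rV[R]_d)) (W : zmodType)
  (J : set 'rV[R]_d -> set 'rV[R]_d -> W) :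
  tiling T -> normal_tiling T -> locally_finite T ->
  (forall x, codim_le T 2 x -> exists a, forall P Q, Defs.adjacent d T P Q -> P x -> Q x ->
     a Q - a P = J P Q) ->
  exists a, forall P Q, Defs.adjacent d T P Q -> a Q - a P = J P Q.
Proof.
move=> T_tiling T_normal T_locfin J_local.
have [P0 TP0 _] := cell_cover T_tiling 0.
have [x0 P0x c0] := generic_cod0 T_locfin (cell_convex T_tiling TP0) (cell_dim T_tiling TP0)
  (cell_compact T_tiling TP0) (@subset_refl _ _).
exact: (based_global_potential T_tiling T_normal T_locfin J_local TP0 P0x c0).
Qed.

(** * Gradients and offsets of the pieces of a generatrix *)

Lemma dotp_row_mx (R : realType) n m (w x : 'rV[R]_n) (v y : 'rV[R]_m) :
  dotp (row_mx w v) (row_mx x y) = dotp w x + dotp v y.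
Proof.
rewrite /dotp big_split_ord /=; congr (_ + _); apply: eq_bigr => i _.
  by rewrite !row_mxEl.
by rewrite !row_mxEr.
Qed.

(** Hulls commute with affine maps. *)
Lemma polytope_affine_image (R : realType) n m (f : 'rV[R]_n -> 'rV[R]_m) (P : set 'rV[R]_n) :
  (forall x y t, f (pt x y t) = pt (f x) (f y) t) -> polytope P -> polytope (f @` P).
Proof.
move=> fpt [s ->]; exists (map f s); apply/seteqP; split.
  move=> _ [x Hx <-].
  apply: (Hx (f @^-1` smallest (@convex_set R 'rV[R]_m) [set` map f s])); split.
    apply/convexP => y z t Hy Hz t0 t1; rewrite /preimage /= fpt.
    by move/convexP: (@convex_hull_convex R m [set` map f s]); apply.
  by move=> y ys; apply: sub_gen_smallest => /=; apply: map_f.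
apply: smallest_sub.
  apply/convexP => _ _ t [y Hy <-] [z Hz <-] t0 t1; exists (pt y z t); last exact: fpt.
  by move/convexP: (@convex_hull_convex R n [set` s]); apply.
by move=> _ /mapP[y ys ->]; exists y => //; exact: sub_gen_smallest.
Qed.

Section Gradients.
Context {R : realType} {d : nat} (T : set (set 'rV[R]_d)).
Hypothesis T_tiling : tiling T.
Hypothesis T_normal : normal_tiling T.
Hypothesis T_locfin : locally_finite T.
Local Notation adj := (Defs.adjacent d T).
Context (s : set 'rV[R]_d -> R) (P0 : set 'rV[R]_d).
Hypothesis s_canonical : canonical_scaling T s.

(** The jumps s (P `&` Q) *: u satisfy the hypothesis of local_potential precisely
    because the scaling is canonical. *)
Lemma scaling_gradients : exists a : set 'rV[R]_d -> 'rV[R]_d, forall P Q u,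
  adj P Q -> directed_unit_normal (P `&` Q) P Q u -> a Q - a P = s (P `&` Q) *: u.
Proof.
have /choice[U HU] : forall PQ : set 'rV[R]_d * set 'rV[R]_d, exists u,
    adj PQ.1 PQ.2 -> directed_unit_normal (PQ.1 `&` PQ.2) PQ.1 PQ.2 u.
  move=> [P Q] /=; have [aPQ|n] := pselect (adj P Q); last by exists 0.
  by have [u Hu] := adjacent_unit_normal T_tiling T_normal T_locfin aPQ; exists u.
pose J P Q := s (P `&` Q) *: U (P, Q).
have [|a Ha] := @global_potential R d T _ J T_tiling T_normal T_locfin; last first.
  exists a => P Q u aPQ Hu; rewrite Ha// /J; congr (_ *: _).
  exact: (unit_normal_uniq T_tiling T_normal T_locfin aPQ Hu (HU (P, Q) aPQ)).
move=> x; apply: local_potential => //.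
  move=> P Q aPQ; rewrite /J setIC -scalerN; congr (_ *: _).
  have Hu := unit_normal_opp (HU (P, Q) aPQ).
  exact: (unit_normal_uniq T_tiling T_normal T_locfin (adjC aPQ) Hu (HU (Q, P) (adjC aPQ))).
move=> k dk Fk m C G CG GE Ca.
have [P TP Px] := cell_cover T_tiling x.
have F2 : tiling_codim2face T (carrier T x).
  by exists P => //; exists k => //; split=> //; apply: face_carrier.
have := s_canonical.2 _ F2 m C G (fun i => U (C i, C (ordS i))) CG.
rewrite /Delta /J => H; under eq_bigr do rewrite -GE.
by apply: H => i; rewrite GE; exact: (HU (C i, C (ordS i)) (Ca i)).
Qed.

(** The offsets are a second potential: around any point x the functions
    dotp (a P) - dotp (a P) x vanish at x and agree on common hyperfaces. *)
Lemma scaling_affine_pieces : exists (a : set 'rV[R]_d -> 'rV[R]_d) (b : set 'rV[R]_d -> R),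
  [/\ a P0 = 0, b P0 = 0,
    forall P Q u, adj P Q -> directed_unit_normal (P `&` Q) P Q u ->
      a Q = a P + s (P `&` Q) *: u &
    forall P Q z, T P -> T Q -> P z -> Q z -> dotp (a P) z + b P = dotp (a Q) z + b Q].
Proof.
have [a Ha] := scaling_gradients.
have aPQ0 P Q y z : adj P Q -> P y -> Q y -> P z -> Q z -> dotp (a Q - a P) y = dotp (a Q - a P) z.
  move=> aPQ Py Qy Pz Qz.
  have [u Hu] := adjacent_unit_normal T_tiling T_normal T_locfin aPQ.
  have [_ [_ un] _] := Hu; rewrite (Ha _ _ _ aPQ Hu) !dotpZl; congr (_ * _).
  by apply/eqP; rewrite -subr_eq0 -dotpBr un.
pose J P Q : R := - dotp (a Q - a P) (xget 0 (P `&` Q)).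
have [|b Hb] := @global_potential R d T _ J T_tiling T_normal T_locfin.
  move=> x _; exists (fun P => - dotp (a P) x) => P Q aPQ Px Qx.
  have [P' Q'] : (P `&` Q) (xget 0 (P `&` Q)) by apply: (@xgetPex _ 0 (P `&` Q)); exists x.
  rewrite /J (aPQ0 P Q _ x aPQ)// dotpBl; ring.
exists (fun P => a P - a P0), (fun P => b P - b P0); rewrite !subrr; split=> //.
  by move=> P Q u aPQ Hu; rewrite -(Ha _ _ _ aPQ Hu) [RHS]addrC addrA subrK.
move=> P Q z TP TQ Pz Qz; rewrite !dotpBl.
suff : dotp (a P) z + b P = dotp (a Q) z + b Q by lra.
apply: (star_connected T_tiling T_normal T_locfin (x := z)
  (E := fun A B => dotp (a A) z + b A = dotp (a B) z + b B)) => //.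
  by move=> A B C _ _ _ _ _ _ -> ->.
move=> A B Az Bz aAB.
have [A' B'] : (A `&` B) (xget 0 (A `&` B)) by apply: (@xgetPex _ 0 (A `&` B)); exists z.
have := Hb _ _ aAB; rewrite /J (aPQ0 A B _ z aAB)// dotpBl; lra.
Qed.

End Gradients.

(** * The lifted complex is a generatrix *)

Section Lifting.
Context {R : realType} {d : nat} (T : set (set 'rV[R]_d)).
Hypothesis T_tiling : tiling T.
Hypothesis T_normal : normal_tiling T.
Hypothesis T_locfin : locally_finite T.
Local Notation adj := (Defs.adjacent d T).
Context (s : set 'rV[R]_d -> R) (P0 : set 'rV[R]_d).
Hypothesis TP0 : T P0.
Context (a : set 'rV[R]_d -> 'rV[R]_d) (b : set 'rV[R]_d -> R).
Hypothesis a0 : a P0 = 0.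
Hypothesis b0 : b P0 = 0.
Hypothesis aS : forall P Q u, adj P Q -> directed_unit_normal (P `&` Q) P Q u ->
  a Q = a P + s (P `&` Q) *: u.
Hypothesis ab : forall P Q z, T P -> T Q -> P z -> Q z ->
  dotp (a P) z + b P = dotp (a Q) z + b Q.
Implicit Types (P Q X : set 'rV[R]_d) (z : 'rV[R]_d).

Definition height z : R :=
  let P := xget set0 [set P | T P /\ P z] in dotp (a P) z + b P.

Lemma heightE P z : T P -> P z -> height z = dotp (a P) z + b P.
Proof.
move=> TP Pz; rewrite /height.
have [TQ Qz] : [set P | T P /\ P z] (xget set0 [set P | T P /\ P z]).
  by apply: (@xgetPex _ set0 [set P | T P /\ P z]); exists P.
exact: ab.
Qed.

Definition up z : 'rV[R]_(d + 1) := row_mx z (const_mx (height z)).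

Definition graph X := up @` X.

(** The normal of the graph of the affine function with gradient a P; the last
    coordinate is that of n0. *)
Definition gradient P : 'rV[R]_(d + 1) := row_mx (a P) (const_mx (- 1)).

Lemma proj_up z : Defs.proj (up z) = z.
Proof. exact: row_mxKl. Qed.

Lemma proj_graph X : Defs.proj @` graph X = X.
Proof.
apply/seteqP; split=> [_ [_ [z Xz <-] <-]|z Xz]; first by rewrite proj_up.
by exists (up z); [exists z | rewrite proj_up].
Qed.

Lemma graph_up X z : graph X (up z) <-> X z.
Proof.
split=> [[y Xy E]|Xz]; last by exists z.
by rewrite -(proj_up z) -E proj_up.
Qed.

Lemma graph_inj X Y : graph X = graph Y -> X = Y.
Proof. by move=> E; rewrite -(proj_graph X) E proj_graph. Qed.

Lemma graphI X Y : graph X `&` graph Y = graph (X `&` Y).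
Proof.
apply/seteqP; split=> [_ [[z Xz <-] /graph_up Yz]|_ [z [Xz Yz] <-]]; first by exists z.
by split; exists z.
Qed.

Lemma dotp_const (x y : R) : dotp (const_mx x : 'rV[R]_1) (const_mx y) = x * y.
Proof. by rewrite /dotp big_ord1 !mxE. Qed.

Lemma gradient_up P z : T P -> P z -> dotp (gradient P) (up z) = - b P.
Proof. move=> TP Pz; rewrite dotp_row_mx dotp_const (heightE TP Pz); ring. Qed.

Lemma graph_polytope P : T P -> polytope (graph P).
Proof.
move=> TP; have -> : graph P = (fun z => row_mx z (const_mx (dotp (a P) z + b P))) @` P.
  by apply/seteqP; split=> _ [z Pz <-]; exists z => //; rewrite /up (heightE TP Pz).
apply: polytope_affine_image; last by case: T_tiling => H _ _; case: (H _ TP).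
move=> x y t; rewrite [in RHS]/pt opp_row_mx add_row_mx scale_row_mx add_row_mx.
congr row_mx; apply/matrixP => i j; rewrite !mxE dotp_pt; ring.
Qed.

(** On P the lift of differences is the linear map row_mx 1 (a P)^T. *)
Lemma graph_dim k P X : T P -> X `<=` P -> affine_dim k X -> affine_dim k (graph X).
Proof.
move=> TP XP [A [Af [x [Xx XA AX]]]].
have upB y : X y -> up y - up x = (y - x) *m row_mx 1%:M (a P)^T.
  move=> Xy; rewrite mul_mx_row mulmx1 /up opp_row_mx add_row_mx; congr row_mx.
  apply/matrixP => i j; rewrite !ord1 -dotpE dotpC dotpBr !mxE.
  by rewrite (heightE TP (XP _ Xy)) (heightE TP (XP _ Xx)); ring.
exists (A *m row_mx 1%:M (a P)^T); split.
  rewrite /row_free eqn_leq rank_leq_row -{1}(eqP Af).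
  have {1}-> : A = A *m row_mx 1%:M (a P)^T *m col_mx 1%:M 0.
    by rewrite -mulmxA mul_row_col mulmx1 mulmx0 addr0 mulmx1.
  exact: mxrankM_maxl.
exists (up x); split; first by exists x.
- move=> i; exists (x + row i A) => //; rewrite row_mul.
  by rewrite [RHS]addrC; apply/eqP; rewrite -subr_eq upB// [x + _]addrC addrK.
- by move=> _ [y Xy <-]; rewrite upB// submxMr// AX.
Qed.

Lemma graph_dim_inv k P X : T P -> X `<=` P -> affine_dim k (graph X) -> affine_dim k X.
Proof.
move=> TP XP Gk; have [m Xm] : exists m, affine_dim m X.
  by apply: ex_affine_dim; have [_ [z Xz _]] := affine_dim_neq0 Gk; exists z.
by rewrite (affine_dim_uniq Gk (graph_dim TP XP Xm)).
Qed.

Lemma graph_face P X : face X P -> face (graph X) (graph P).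
Proof.
move=> [[x Xx] [w [c [wP XE]]]]; split; first by exists (up x); exists x.
exists (row_mx w 0), c; have E z : dotp (row_mx w 0) (up z) = dotp w z.
  by rewrite dotp_row_mx dotp0l addr0.
split=> [_ [z Pz <-]|]; first by rewrite E wP.
rewrite XE; apply/seteqP; split=> [_ [z [Pz wz] <-]|_ [[z Pz <-] wz]].
  by split; [exists z | rewrite /= E].
by exists z => //; split=> //; rewrite /= -E.
Qed.

(** A functional on the graph of an affine function is an affine function below. *)
Lemma face_graph P Y : T P -> face Y (graph P) ->
  exists X, [/\ Y = graph X, X `<=` P & face X P].
Proof.
move=> TP [[y Yy] [w [c [wP YE]]]].
pose v := lsubmx w + rsubmx w 0 0 *: a P.
have wE z : P z -> dotp w (up z) = dotp v z + rsubmx w 0 0 * b P.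
  move=> Pz; rewrite -{1}[w]hsubmxK dotp_row_mx.
  have -> : rsubmx w = const_mx (rsubmx w 0 0) by apply/matrixP => i j; rewrite !ord1 [RHS]mxE.
  rewrite dotp_const (heightE TP Pz) /v dotpDl dotpZl !mxE; ring.
pose X := P `&` [set z | dotp v z = c - rsubmx w 0 0 * b P].
have YX : Y = graph X.
  rewrite YE; apply/seteqP; split=> [_ [[z Pz <-] /= wz]|_ [z [Pz /= vz] <-]].
    by exists z => //; split=> //=; rewrite -wz wE// addrK.
  by split; [exists z | rewrite /= wE// vz subrK].
exists X; split=> //; first by move=> z [].
split; first by move: Yy; rewrite YX => -[z Xz _]; exists z.
exists v, (c - rsubmx w 0 0 * b P); split=> // z Pz.
by rewrite lerBrDr -wE//; apply: wP; exists z.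
Qed.

Lemma graph_hyperface P X : T P -> hyperface d X P -> hyperface d (graph X) (graph P).
Proof.
move=> TP [k dk [XP Xk]]; exists k => //; split; first exact: graph_face.
apply: (graph_dim TP _ Xk) => z Xz.
by case: XP => _ [w [c [_ XE]]]; move: Xz; rewrite XE => -[].
Qed.

Lemma hyperface_graph P Y : T P -> hyperface d Y (graph P) ->
  exists2 X, Y = graph X & hyperface d X P.
Proof.
move=> TP [k dk [YP Yk]]; have [X [E XP Xf]] := face_graph TP YP.
exists X => //; exists k => //; split=> //; apply: (graph_dim_inv TP XP).
by rewrite -E.
Qed.

(** Pairing with the gradient is constant on the graph but not along n0. *)
Lemma graph_is_lift P : T P -> is_lift d P (graph P).
Proof.
move=> TP; split; last exact: proj_graph.
  split; first exact: graph_polytope.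
  exact: (graph_dim TP (@subset_refl _ _) (cell_dim T_tiling TP)).
move=> A [_ [x [Px PA _]]]; apply/negP => n0A.
have gP y : graph P y -> dotp (gradient P) y = - b P.
  by move=> [z Pz <-]; exact: gradient_up.
have gA : A *m (gradient P)^T = 0.
  apply/matrixP => i j; rewrite ord1 row_mul_dotp mxE.
  by have := gP _ (PA i); rewrite dotpDr (gP _ Px); lra.
have := sub_dotp0 gA n0A.
by rewrite dotp_row_mx dotp0r dotp_const mulrNN mulr1 add0r => /eqP; rewrite oner_eq0.
Qed.

Lemma graph_normal P : T P -> normal_vector (graph P) (gradient P).
Proof.
move=> TP; split.
  apply/eqP => /(congr1 rsubmx); rewrite row_mxKr => /matrixP/(_ 0 0)/eqP.
  by rewrite !mxE oppr_eq0 oner_eq0.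
by move=> _ _ [x Px <-] [y Py <-]; rewrite dotpBr !gradient_up// subrr.
Qed.

Lemma gradient_step P Q u : adj P Q -> directed_unit_normal (P `&` Q) P Q u ->
  gradient P + s (P `&` Q) *: embed u = gradient Q.
Proof.
move=> aPQ Hu; rewrite /gradient /embed scale_row_mx scaler0 add_row_mx addr0.
by rewrite (aS aPQ Hu).
Qed.

Lemma graph_lift_up_to P Q : T P -> T Q -> P `&` Q !=set0 ->
  lift_up_to P (graph P) Q (graph Q).
Proof.
move=> TP TQ [x PQx]; have [E|[fP fQ]] := T_normal TP TQ; first by move: PQx; rewrite E.
split; first exact: graph_is_lift.
- by rewrite graphI; exact: graph_face.
- by rewrite graphI; exact: graph_face.
- by rewrite graphI proj_graph.
Qed.

(** The normal fixes L up to a vertical translation, and the nonempty intersection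
    with graph P fixes the translation. *)
Lemma lift_uniq P Q L : T P -> T Q -> lift_up_to P (graph P) Q L ->
  normal_vector L (gradient Q) -> L = graph Q.
Proof.
move=> TP TQ [[_ _ LQ] [[y [[x Px <-] Lx]] _] _ _] [_ nL].
have QL (z : 'rV[R]_(d + 1)) : L z -> Q (Defs.proj z) by move=> Lz; rewrite -LQ; exists z.
have Qx : Q x by rewrite -(proj_up x); exact: QL.
have LE (z : 'rV[R]_(d + 1)) : L z -> z = up (Defs.proj z).
  move=> Lz; have := nL _ _ Lz Lx; rewrite dotpBr gradient_up//.
  rewrite -{1}[z]hsubmxK.
  have zE : rsubmx z = const_mx (rsubmx z 0 0) by apply/matrixP => i j; rewrite !ord1 [RHS]mxE.
  rewrite {1}zE dotp_row_mx dotp_const => E.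
  rewrite -[LHS]hsubmxK /up; congr row_mx; rewrite zE; congr const_mx.
  have := QL _ Lz; rewrite /Defs.proj => Qz.
  rewrite (heightE TQ Qz); lra.
apply/seteqP; split=> [z Lz|_ [z Qz <-]].
  by rewrite (LE _ Lz); exists (Defs.proj z) => //; exact: QL.
by move: Qz; rewrite -LQ => -[z' Lz' <-]; rewrite -LE.
Qed.

(** Path independence: the lift and the normal assigned to a chain are read off the
    global pieces, so they depend only on the last cell. *)
Lemma chain_lift_graph c L N : chain_lift T s P0 c L N ->
  exists c' P, [/\ c = rcons c' P, T P, L = graph P & N = gradient P].
Proof.
elim=> [|c' P Q L' N' u L'' _ [c1 [P1 [/rcons_inj[_ <-] TP -> ->]]] aPQ Hu HL nL].
  exists [::], P0; split=> //; last by rewrite /gradient a0.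
  apply/seteqP; split=> _ [z Pz <-]; exists z => //; rewrite /up (heightE TP0 Pz) a0 b0 dotp0l addr0.
    by congr row_mx; apply/matrixP => i j; rewrite !mxE.
  by congr row_mx; apply/matrixP => i j; rewrite !mxE.
have [_ TQ _ _] := aPQ; rewrite (gradient_step aPQ Hu) in nL *.
exists (rcons c' P), Q; split=> //; exact: lift_uniq HL nL.
Qed.

Lemma chain_lift_extend c P Q : adj P Q ->
  chain_lift T s P0 (rcons c P) (graph P) (gradient P) ->
  chain_lift T s P0 (rcons (rcons c P) Q) (graph Q) (gradient Q).
Proof.
move=> aPQ HP; have [TP TQ _ _] := aPQ.
have [u Hu] := adjacent_unit_normal T_tiling T_normal T_locfin aPQ.
rewrite -(gradient_step aPQ Hu); apply: (chain_lift_step HP aPQ Hu).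
  apply: graph_lift_up_to => //.
  by have [k [_ Hk _ _ _]] := adjacent_cap T_tiling T_normal aPQ; exact: affine_dim_neq0 Hk.
by rewrite (gradient_step aPQ Hu); exact: graph_normal.
Qed.

Lemma chain_lift_ex P : T P -> exists c, chain_lift T s P0 (rcons c P) (graph P) (gradient P).
Proof.
move=> TP; pose reach A := exists c, chain_lift T s P0 (rcons c A) (graph A) (gradient A).
apply: (tiling_connected T_tiling T_normal T_locfin (E := fun A B => reach A -> reach B) _ _ _ TP0 TP) => //.
- by move=> A B C _ _ _ AB BC /AB.
- by move=> A B aAB [c Hc]; exists (rcons c A); exact: chain_lift_extend.
exists [::]; have := chain_lift_start T s P0.
move=> /[dup] /chain_lift_graph[c' [P' [E _ -> ->]]].
by have [_ <-] := @rcons_inj _ [::] c' P0 P' E.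
Qed.

Lemma chain_lift_adj c P Q L N : chain_lift T s P0 (rcons (rcons c P) Q) L N -> adj P Q.
Proof.
move E : (rcons _ _) => cc H; case: H E.
  by move=> /(congr1 size); rewrite !size_rcons.
by move=> c' P' Q' L0 N0 u L' _ aPQ _ _ _ /rcons_inj[/rcons_inj[_ ->] ->].
Qed.

Local Notation K := (lifted_complex T s P0).

Lemma lifted_cells : cells K = [set graph P | P in T].
Proof.
apply/seteqP; split=> [L [c [N /chain_lift_graph[c' [P [_ TP -> _]]]]]|_ [P TP <-]].
  by exists P.
by have [c Hc] := chain_lift_ex TP; exists (rcons c P), (gradient P).
Qed.

Lemma lifted_adj L L' : cell_adj K L L' <-> Defs.adjacent d (cells K) L L'.
Proof.
have cons c P Q N N' M M' : chain_lift T s P0 (rcons c P) M N ->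
    chain_lift T s P0 (rcons (rcons c P) Q) M' N' -> Defs.adjacent d (cells K) M M'.
  move=> H1 H2; have aPQ := chain_lift_adj H2; have [TP TQ PQ _] := aPQ.
  have [_ [_ [/rcons_inj[_ <-] _ -> _]]] := chain_lift_graph H1.
  have [_ [_ [/rcons_inj[_ <-] _ -> _]]] := chain_lift_graph H2.
  have [k [_ _ hP hQ _]] := adjacent_cap T_tiling T_normal aPQ.
  split.
  - by rewrite lifted_cells; exists P.
  - by rewrite lifted_cells; exists Q.
  - by move=> /graph_inj.
  - by exists (graph (P `&` Q)); split; exact: graph_hyperface.
have adjK M M' : Defs.adjacent d (cells K) M M' -> Defs.adjacent d (cells K) M' M.
  by case=> TP TQ PQ [H [HP HQ]]; split=> //; [exact: nesym | exists H].
split=> [[[c [P [Q [N [N' [H1 H2]]]]]]|[c [P [Q [N [N' [H1 H2]]]]]]]|].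
- exact: cons H1 H2.
- by apply: adjK; exact: cons H1 H2.
rewrite lifted_cells => -[[P TP <-] [Q TQ <-] PQ [H [HP HQ]]].
have [X HX XP] := hyperface_graph TP HP; have [Y HY YQ] := hyperface_graph TQ HQ.
have XY : X = Y by apply: graph_inj; rewrite -HX.
have aPQ : adj P Q.
  by split=> // [E|]; [apply: PQ; rewrite E | exists X; split=> //; rewrite XY].
have [c Hc] := chain_lift_ex TP.
by left; exists c, P, Q, (gradient P), (gradient Q); split=> //; exact: chain_lift_extend.
Qed.

(** By cap_relint, P `&` Q is the carrier of one of its points x. It is a face of
    every cell around x and lies in every hyperface through which these cells are
    connected. *)
Lemma lifted_incident P Q : T P -> T Q -> P `&` Q !=set0 ->
  incident d K (graph P `&` graph Q) (graph P) (graph Q).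
Proof.
move=> TP TQ PQ0; rewrite graphI.
have [x Fx [Px Qx]] := cap_relint T_tiling T_normal T_locfin TP TQ PQ0.
have ff A : T A -> A x -> face (graph (P `&` Q)) (graph A).
  by move=> TA Ax; rewrite -Fx; apply: graph_face; exact: face_carrier.
pose I A := incident d K (graph (P `&` Q)) (graph P) (graph A).
suff : I P -> I Q.
  by apply; apply: incident_self; [rewrite lifted_cells; exists P | exact: ff].
apply: (star_connected T_tiling T_normal T_locfin (x := x) (E := fun A B => I A -> I B)) => //.
  by move=> A B C _ _ _ _ _ _ AB BC /AB.
move=> A B Ax Bx aAB IA; have [TA TB AB _] := aAB.
have [k [_ _ hA hB _]] := adjacent_cap T_tiling T_normal aAB.
apply: (incident_step IA (H := graph (A `&` B))).
- apply/lifted_adj; split.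
  + by rewrite lifted_cells; exists A.
  + by rewrite lifted_cells; exists B.
  + by move=> /graph_inj.
  + by exists (graph (A `&` B)); split; exact: graph_hyperface.
- exact: graph_hyperface.
- exact: graph_hyperface.
- move=> _ [z Fz <-]; exists z => //; rewrite -Fx in Fz.
  by split; exact: Fz.
- exact: ff.
Qed.

Lemma proj_continuous : continuous (@Defs.proj R d).
Proof.
move=> y; apply: cvg_rV_coord => j; rewrite /Defs.proj.
under eq_fun do rewrite mxE; rewrite mxE; exact: coord_continuous.
Qed.

(** Locally finitely many cells, each contributing an affine function. *)
Lemma height_continuous : continuous height.
Proof.
move=> x A xA.
have /finite_seqP[c cE] := star_finite T_locfin x.
have H : \forall y \near x, forall P, P \in c -> T P -> P x -> A (dotp (a P) y + b P).
  elim: (c) => [|P r IH]; first exact: filterE.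
  have HP : \forall y \near x, T P -> P x -> A (dotp (a P) y + b P).
    have [[TP Px]|n] := pselect (T P /\ P x); last by apply: filterE => y TP Px; case: n.
    rewrite (heightE TP Px) in xA.
    have C1 : (fun _ : 'rV[R]_d => b P) @ x --> b P.
      by move=> B /nbhs_singleton B0; exact: (@filterE _ (nbhs x) _ (fun=> B _) (fun=> B0)).
    have C2 : (fun y => dotp (a P) y + b P) @ x --> dotp (a P) x + b P.
      exact: (cvgD (@dotp_continuous R d (a P) x) C1).
    have N : \forall y \near x, A (dotp (a P) y + b P) by exact: (C2 A xA).
    by apply: filterS N.
  by apply: filterS2 HP IH => y H1 H2 P'; rewrite inE => /orP[/eqP->|/H2].
apply: filterS2 H (near_star T_tiling T_locfin x) => y H Hy.
have [P TP Py] := cell_cover T_tiling y; have Px := Hy _ TP Py.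
rewrite /preimage /= (heightE TP Py); apply: H => //.
by have : [set P | T P /\ P x] P by []; rewrite cE.
Qed.

Lemma up_continuous : continuous up.
Proof.
move=> x; apply: cvg_rV_coord => j; rewrite /up; case: (split_ordP j) => i ->.
  under eq_fun do rewrite row_mxEl; rewrite row_mxEl; exact: coord_continuous.
under eq_fun do rewrite row_mxEr mxE; rewrite row_mxEr mxE; exact: height_continuous.
Qed.

Lemma lifted_body : body K = range up.
Proof.
rewrite /body lifted_cells; apply/seteqP; split=> [_ [_ [P TP <-] [z Pz <-]]|_ [z _ <-]].
  by exists z.
have [P TP Pz] := cell_cover T_tiling z.
by exists (graph P); [exists P | exists z].
Qed.

Lemma lifted_generatrix : generatrix T K.
Proof.
have cellsP L : cells K L -> exists2 P, T P & L = graph P.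
  by rewrite lifted_cells => -[P TP <-]; exists P.
split.
- split.
    split.
    + by move=> L /cellsP[P TP ->]; have [] := graph_is_lift TP.
    + exact: lifted_adj.
    + move=> L L' /cellsP[P TP ->] /cellsP[Q TQ ->].
      have [[x PQx]|PQ0] := pselect (P `&` Q !=set0).
        by right; apply: lifted_incident => //; exists x.
      by left; rewrite graphI; apply/seteqP; split=> // y [x PQx _]; case: PQ0; exists x.
    + move=> y; have [U yU Uf] := T_locfin (Defs.proj y).
      exists (Defs.proj @^-1` U); first exact: proj_continuous.
      have fin := finite_image graph Uf; apply: sub_finite_set fin => L [/cellsP[P TP ->] [_ [[z Pz <-]]]].
      by rewrite /preimage /= proj_up => Uz; exists P => //; split=> //; exists z.
  move=> y Ky; exists setT, setT, (@Defs.proj R d), up; split.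
  + by split=> //; exact: openT.
  + exact: openT.
  + by split; apply: continuous_subspaceT; [exact: proj_continuous | exact: up_continuous].
  + by split=> // z _; split=> //; rewrite lifted_body; exists z.
  + split=> [z [Kz _]|z _]; last exact: proj_up.
    by move: Kz; rewrite lifted_body => -[x _ <-]; rewrite proj_up.
- rewrite lifted_body; split=> //.
  + move=> y z /set_mem[y' _ <-] /set_mem[z' _ <-].
    by rewrite !proj_up => ->.
  + by move=> z _; exists (up z); [exists z | exact: proj_up].
- rewrite lifted_cells; apply/seteqP; split=> [_ [_ [P TP <-] <-]|P TP].
    by rewrite proj_graph.
  by exists (graph P); [exists P | exact: proj_graph].
Qed.

End Lifting.

(** * Canonical scalings from convex generatrices *)

Lemma bounded_functional_eq0 (R : realType) n (w : 'rV[R]_n) b :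
  (forall z, dotp w z <= b) -> w = 0.
Proof.
move=> H; apply/eqP; apply/negPn/negP => w0; have ww := dotp_gt0 w0.
have := H (((b + 1) / dotp w w) *: w); rewrite dotpZr mulfVK ?gt_eqF//; lra.
Qed.

Section Converse.
Context {R : realType} {d : nat} (T : set (set 'rV[R]_d)).
Hypothesis T_tiling : tiling T.
Hypothesis T_normal : normal_tiling T.
Hypothesis T_locfin : locally_finite T.
Local Notation adj := (Defs.adjacent d T).
Implicit Types (P Q H : set 'rV[R]_d) (z : 'rV[R]_d).

(** The bijection onto the base turns the body into the graph of a function f, and a
    supporting hyperplane of a cell into the coefficients w, l and c. *)
Lemma supporting_functionals (K : complex R (d + 1)) : generatrix T K -> convex_surface K ->
  exists (f : 'rV[R]_d -> R) (w : set 'rV[R]_d -> 'rV[R]_d) (l c : set 'rV[R]_d -> R),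
  forall P, T P -> (forall z, dotp (w P) z + l P * f z <= c P) /\
    (forall z, P z <-> dotp (w P) z + l P * f z = c P).
Proof.
move=> [_ [_ inj surj] KT] Kconv.
have /choice[g Hg] : forall z, exists y, body K y /\ Defs.proj y = z.
  by move=> z; have [//|y Ky yz] := surj z; exists y.
have gK y : body K y -> g (Defs.proj y) = y.
  by move=> Ky; have [Kg pg] := Hg (Defs.proj y); apply: inj; rewrite ?pg //; exact: mem_set.
pose f z := rsubmx (g z) 0 0.
have gE z : g z = row_mx z (const_mx (f z)).
  rewrite -[LHS]hsubmxK; congr row_mx; first exact: (Hg z).2.
  by apply/matrixP => i j; rewrite !ord1 [RHS]mxE.
have /choice[wlc H] : forall P, exists wlc : 'rV[R]_d * R * R,
    T P -> (forall z, dotp wlc.1.1 z + wlc.1.2 * f z <= wlc.2) /\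
    (forall z, P z <-> dotp wlc.1.1 z + wlc.1.2 * f z = wlc.2).
  move=> P; have [TP|nTP] := pselect (T P); last by exists (0, 0, 0).
  have [k Kk kP] : [set [set Defs.proj x | x in k] | k in cells K] P by rewrite KT.
  have [_ [w [c [wK kE]]]] := Kconv _ Kk.
  have wE z : dotp w (g z) = dotp (lsubmx w) z + rsubmx w 0 0 * f z.
    rewrite gE -{1}[w]hsubmxK dotp_row_mx; congr (_ + _).
    have {1}-> : rsubmx w = const_mx (rsubmx w 0 0) by apply/matrixP => i j; rewrite !ord1 [RHS]mxE.
    exact: dotp_const.
  exists (lsubmx w, rsubmx w 0 0, c) => _ /=; split=> z; rewrite -wE.
    by apply: wK; exact: (Hg z).1.
  split=> [|wz].
    rewrite -kP => -[y ky <-].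
    have := ky; rewrite kE => -[Ky /= wy]; by rewrite gK.
  rewrite -kP; exists (g z); last exact: (Hg z).2.
  by rewrite kE; split=> //; exact: (Hg z).1.
by exists f, (fun P => (wlc P).1.1), (fun P => (wlc P).1.2), (fun P => (wlc P).2).
Qed.

Context (f : 'rV[R]_d -> R) (w : set 'rV[R]_d -> 'rV[R]_d) (l c : set 'rV[R]_d -> R).
Hypothesis wP : forall P, T P -> (forall z, dotp (w P) z + l P * f z <= c P) /\
    (forall z, P z <-> dotp (w P) z + l P * f z = c P).

Lemma adj_sub P Q : adj P Q -> (forall z, P z) -> False.
Proof.
by move=> [TP TQ PQ _] Pz; apply: PQ; apply/esym; apply: (sub_cell_eq T_tiling TQ TP) => z _.
Qed.

(** A vertical supporting hyperplane would bound the whole base. *)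
Lemma adj_nonvertical P Q : adj P Q -> l P != 0.
Proof.
move=> aPQ; apply/eqP => l0; have [TP _ _ _] := aPQ; have [H1 H2] := wP TP.
have w0 : w P = 0.
  by apply: (@bounded_functional_eq0 _ _ _ (c P)) => z; have := H1 z; rewrite l0 mul0r addr0.
have [z0 Pz0] := affine_dim_neq0 (cell_dim T_tiling TP).
apply: (adj_sub aPQ) => z; apply/H2; rewrite -(iffLR (H2 z0) Pz0).
by rewrite w0 l0 !dotp0l !mul0r.
Qed.

Definition slope P := - (l P)^-1 *: w P.
Definition offset P := c P / l P.

(** P is the zero set of side P, and the surface lies on one side of the graph of
    the affine function slope P, offset P; the sign of l P tells on which one. *)
Definition side P (z : 'rV[R]_d) := f z - (dotp (slope P) z + offset P).

Lemma sideE P z : l P != 0 -> side P z = (dotp (w P) z + l P * f z - c P) / l P.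
Proof. by move=> l0; rewrite /side /slope /offset dotpZl; field. Qed.

Lemma side_eq0 P z : T P -> l P != 0 -> (P z <-> side P z = 0).
Proof.
move=> TP l0; rewrite sideE//; split=> [/(wP TP).2 ->|]; first by rewrite subrr mul0r.
move=> /eqP; rewrite mulf_eq0 invr_eq0 (negPf l0) orbF subr_eq0 => /eqP.
by move=> /(wP TP).2.
Qed.

Lemma side_sign P z : T P -> l P != 0 -> 0 <= - Num.sg (l P) * side P z.
Proof.
move=> TP l0; rewrite sideE//; have := (wP TP).1 z; rewrite -subr_ge0 => H.
have -> : - Num.sg (l P) * ((dotp (w P) z + l P * f z - c P) / l P) =
    (Num.sg (l P) / l P) * (c P - (dotp (w P) z + l P * f z)) by ring.
apply: mulr_ge0 => //; have [ln|lp|E] := ltrgtP (l P) 0.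
- by rewrite ltr0_sg// mulN1r oppr_ge0 invr_le0 ltW.
- by rewrite gtr0_sg// mul1r invr_ge0 ltW.
- by rewrite E eqxx in l0.
Qed.

Lemma adj_common P Q : adj P Q -> exists z, P z /\ Q z.
Proof.
by move=> /adjacent_cap[//|//|k [_ /affine_dim_neq0[z [Pz Qz]] _ _ _]]; exists z.
Qed.

(** Cells with equal slopes lie in the same supporting hyperplane, which cuts out
    only one cell. *)
Lemma slope_neq P Q : adj P Q -> slope Q - slope P != 0.
Proof.
move=> aPQ; have [TP TQ PQ _] := aPQ; have lP := adj_nonvertical aPQ.
have lQ := adj_nonvertical (adjC aPQ).
rewrite subr_eq0; apply/eqP => E; apply: PQ.
have [z0 [/(side_eq0 z0 TP lP) P0 /(side_eq0 z0 TQ lQ) Q0]] := adj_common aPQ.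
have oE : offset P = offset Q by move: P0 Q0; rewrite /side E; lra.
apply/seteqP; split=> z.
  by move=> /(side_eq0 z TP lP) Pz; apply/(side_eq0 z TQ lQ); rewrite /side E -oE.
by move=> /(side_eq0 z TQ lQ) Qz; apply/(side_eq0 z TP lP); rewrite /side -E oE.
Qed.

(** Adjacent cells are supported from the same side: otherwise the surface would
    lie between two parallel hyperplanes with a common point. *)
Lemma sign_adj P Q : adj P Q -> Num.sg (l Q) = Num.sg (l P).
Proof.
have opposite A B : adj A B -> l A < 0 -> 0 < l B -> False.
  move=> aAB lA lB; have [TA TB _ _] := aAB.
  have lA0 : l A != 0 by rewrite lt_eqF.
  have lB0 : l B != 0 by rewrite gt_eqF.
  case/eqP: (slope_neq (adjC aAB)).
  apply: (@bounded_functional_eq0 _ _ _ (offset B - offset A)) => z.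
  have := side_sign z TA lA0; have := side_sign z TB lB0.
  rewrite (ltr0_sg lA) (gtr0_sg lB) opprK mul1r mulN1r /side dotpBl; lra.
move=> aPQ; have lP := adj_nonvertical aPQ; have lQ := adj_nonvertical (adjC aPQ).
have [Pn|Pp|E] := ltrgtP (l P) 0; last by rewrite E eqxx in lP.
  have [Qn|Qp|E] := ltrgtP (l Q) 0; last by rewrite E eqxx in lQ.
    by rewrite !ltr0_sg.
  by case: (opposite _ _ aPQ).
have [Qn|Qp|E] := ltrgtP (l Q) 0; last by rewrite E eqxx in lQ.
  by case: (opposite _ _ (adjC aPQ)).
by rewrite !gtr0_sg.
Qed.

Definition bend P Q := Num.sqrt (dotp (slope Q - slope P) (slope Q - slope P)).

(** The difference of the two supporting affine functions changes sign across the
    common hyperface, hence its gradient points along the normal. *)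
Lemma bend_normal P Q u : adj P Q -> directed_unit_normal (P `&` Q) P Q u ->
  - Num.sg (l P) *: (slope Q - slope P) = bend P Q *: u.
Proof.
move=> aPQ Hu; have [TP TQ PQ _] := aPQ; have lP := adj_nonvertical aPQ.
have lQ := adj_nonvertical (adjC aPQ); have sPQ := sign_adj aPQ.
set g := - Num.sg (l P); pose v := g *: (slope Q - slope P).
have g2 : g * g = 1 by rewrite /g mulrNN -expr2 sqr_sg lP.
have vv : dotp v v = dotp (slope Q - slope P) (slope Q - slope P).
  by rewrite /v dotpZl dotpZr mulrA g2 mul1r.
have vE z : dotp v z = g * (side P z - side Q z) + g * (offset P - offset Q).
  by rewrite /v dotpZl dotpBl /side; ring.
have nP z : P z -> dotp v z <= g * (offset P - offset Q).
  move=> /(side_eq0 z TP lP) Pz; rewrite vE Pz sub0r mulrN gerDr oppr_le0 /g -sPQ.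
  exact: side_sign.
have nQ z : Q z -> g * (offset P - offset Q) <= dotp v z.
  by move=> /(side_eq0 z TQ lQ) Qz; rewrite vE Qz subr0 lerDr; exact: side_sign.
rewrite -/v /bend -vv; apply: (unit_normal_scale T_tiling T_normal T_locfin aPQ Hu).
  move=> y z Py Qy Pz Qz; rewrite dotpBr.
  by have := nP _ Py; have := nQ _ Qy; have := nP _ Pz; have := nQ _ Qz; lra.
by move=> y z Py Qz; exact: le_trans (nP _ Py) (nQ _ Qz).
Qed.

Lemma bend_gt0 P Q : adj P Q -> 0 < bend P Q.
Proof. by move=> /slope_neq/dotp_gt0; rewrite /bend sqrtr_gt0. Qed.

Lemma bendC P Q : bend Q P = bend P Q.
Proof.
by rewrite /bend -[slope P - slope Q]opprB dotpNl dotpNr opprK.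
Qed.

(** A hyperface lies in no more than two cells, so it determines the pair that it
    separates up to order. *)
Lemma bend_scaling : exists s : set 'rV[R]_d -> R,
  (forall H, 0 < s H) /\ forall P Q, adj P Q -> s (P `&` Q) = bend P Q.
Proof.
pose pairs H := [set PQ | adj PQ.1 PQ.2 /\ H = PQ.1 `&` PQ.2].
pose s H : R := let PQ := xget (set0, set0) (pairs H) in
  if pselect (adj PQ.1 PQ.2) then bend PQ.1 PQ.2 else 1.
exists s; split=> [H|P Q aPQ]; first by rewrite /s; case: pselect => //= /bend_gt0.
rewrite /s; have [a' HE] : pairs (P `&` Q) (xget (set0, set0) (pairs (P `&` Q))).
  by apply: (@xgetPex _ (set0, set0) (pairs (P `&` Q))); exists (P, Q).
case: pselect => //= _; set PQ := xget _ _ in a' HE *.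
have [x [Px Qx Fx cx]] := adjacent_relint T_tiling T_normal T_locfin aPQ.
have [P'x Q'x] : (PQ.1 `&` PQ.2) x by rewrite -HE.
have [TP TQ nPQ _] := aPQ; have [TP' TQ' nPQ' _] := a'.
have two := cod1_two_cells T_tiling T_normal T_locfin cx.
have [//|EP|EP] := two _ _ _ TP TQ TP' Px Qx P'x.
  have [//|EQ|EQ] := two _ _ _ TP TQ TQ' Px Qx Q'x.
    by case: nPQ'; rewrite -EP -EQ.
  by rewrite -EP -EQ.
have [//|EQ|EQ] := two _ _ _ TP TQ TQ' Px Qx Q'x.
  by rewrite -EP -EQ bendC.
by case: nPQ'; rewrite -EP -EQ.
Qed.

Lemma canonical_scaling_ex : exists s, canonical_scaling T s.
Proof.
have [s [s0 sE]] := bend_scaling; exists s; split; first by move=> H _.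
move=> F _ k C G u [_ _ CG] Hu; rewrite /Delta.
have aC i : adj (C i) (C (ordS i)).
  by have [TC TC' nC h h'] := CG i; split=> //; exists (G i).
have GE i : G i = C i `&` C (ordS i).
  have [m [_ _ _ _ E]] := adjacent_cap T_tiling T_normal (aC i).
  by have [_ _ _ h h'] := CG i; exact: E.
(* The sum telescopes: the sign may be attached to either of two adjacent cells. *)
pose h i := - Num.sg (l (C i)) *: slope (C i).
have E i : s (G i) *: u i = h (ordS i) - h i.
  rewrite GE sE// -(bend_normal (aC i)); last by rewrite -GE; exact: Hu.
  by rewrite /h (sign_adj (aC i)) scalerBr.
under eq_bigr do rewrite E.
rewrite sumrB [X in _ - X](reindex_inj (can_inj (@ordSK k))) /=; exact: subrr.
Qed.

End Converse.

Theorem mainTheorem2 (R : realType) (d : nat) (T : set (set 'rV[R]_d))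
  (T_tiling : tiling T) (T_normal : normal_tiling T)
  (T_locfin : locally_finite T) :
  (forall (s : set 'rV[R]_d -> R) (P0 : set 'rV[R]_d), T P0 ->
     canonical_scaling T s -> generatrix T (lifted_complex T s P0)) /\
  ((exists K : complex R (d + 1), generatrix T K /\ convex_surface K) ->
   exists s : set 'rV[R]_d -> R, canonical_scaling T s).
Proof.
split=> [s P0 TP0 s_canonical|[K [KT Kconv]]].
  have [a [b [a0 b0 aS ab]]] := scaling_affine_pieces T_tiling T_normal T_locfin P0 s_canonical.
  exact: (lifted_generatrix T_tiling T_normal T_locfin TP0 a0 b0 aS ab).
have [f [w [l [c wP]]]] := supporting_functionals KT Kconv.
exact: (canonical_scaling_ex T_tiling T_normal T_locfin wP).
Qed.
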